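(* For well-formed CCCP configurations $\mathcal C_1,\mathcal C_2$: if $\mathcal C_1\simeq\mathcal C_2$ then $\mathcal C_1\approx\mathcal C_2$. More precisely, the relation $\{(\mathcal C_1,\mathcal C_2)\mid \mathcal C_1,\mathcal C_2\text{ well-formed},\ \mathcal C_1\simeq\mathcal C_2\}$ is a bisimulation.
   Context: CCCP syntax. Fix a set of channels (ranged over by $c,d$) and a set of values containing data variables $x,y$ and a special error value $\mathtt{err}$; closed values $v,w$ contain no variables, and each closed value $v$ has a transmission time $\delta_v\in\mathbb{N}$ with $\delta_v\ge 1$. Expressions $e$ are built from values; closed expressions evaluate to closed values via $[\![e]\!]$. Station code (processes) is given by $P,Q ::= c!\langle e\rangle.P \mid \lfloor ?c(x).P\rfloor Q \mid \sigma.P \mid \tau.P \mid P+Q \mid [b]P,Q \mid X \mid \mathbf{0} \mid \mathrm{fix}\,X.P$, where $b$ is either $e_1=e_2$ or $\mathrm{exp}(c)$, $[b]P,Q$ is a conditional (then-branch $P$, else-branch $Q$), $\lfloor ?c(x).P\rfloor Q$ is a receiver on $c$ with timeout branch $Q$ ($x$ bound in $P$), $\sigma.P$ is a one-unit delay and $\sigma^n.P$ denotes $n$ nested delays. System terms are $W ::= P \mid \lfloor ?c(x).P\rfloor \mid W_1|W_2 \mid \nu c{:}(n,v).W$, where $\lfloor ?c(x).P\rfloor$ is an active receiver ($x$ bound in $P$) and $\nu c{:}(n,v).W$ restricts $c$ with local channel state $(n,v)$. In $\mathrm{fix}\,X.P$ every occurrence of $X$ in $P$ is guarded, i.e. lies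 within a broadcast prefix, a receiver continuation, a timeout branch, a $\sigma$-prefix, or a branch of a conditional. Terms are identified up to $\alpha$-conversion. A channel environment is a map $\Gamma$ from channels to $\mathbb{N}\times$(closed values); write $\Gamma\vdash_t c:n$ and $\Gamma\vdash_v c:w$ when $\Gamma(c)=(n,w)$; $c$ is idle in $\Gamma$ if $\Gamma\vdash_t c:0$ and exposed otherwise; $\Gamma[c\mapsto(n,v)]$ is $\Gamma$ updated at $c$; $\Gamma\le\Gamma'$ iff for every $c$, $\Gamma\vdash_t c:n$ and $\Gamma'\vdash_t c:m$ imply $n\le m$. A configuration $\Gamma\triangleright W$ is a channel environment together with a closed system term (no free data or process variables). Intensional semantics. Actions $\lambda$ are $c!v$, $c?v$, $\sigma$, $\tau$. The environment update $\lambda(\Gamma)$ is: $\sigma(\Gamma)(c)=(\max(n-1,0),w)$ whenever $\Gamma(c)=(n,w)$; $c!v(\Gamma)$ agrees with $\Gamma$ except at $c$, where it is $(\delta_v,v)$ if $c$ is idle in $\Gamma$ and $(\max(\delta_v,n),\mathtt{err})$ if $\Gamma\vdash_t c:n>0$; $c?v(\Gamma)=c!v(\Gamma)$; $\tau(\Gamma)=\Gamma$. The predicate $\mathrm{rcv}(W,c)$ on terms is: true for $\lfloor ?d(x).P\rfloor Q$ iff $d=c$; $\mathrm{rcv}(P+Q,c)=\mathrm{rcv}(P,c)\vee\mathrm{rcv}(Q,c)$; $\mathrm{rcv}(\mathrm{fix}\,X.P,c)=\mathrm{rcv}(P,c)$; $\mathrm{rcv}(W_1|W_2,c)=\mathrm{rcv}(W_1,c)\vee\mathrm{rcv}(W_2,c)$;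 $\mathrm{rcv}(\nu d{:}(n,v).W,c)=\mathrm{rcv}(W,c)$ (with $d\neq c$ by $\alpha$-conversion); false for all other forms (broadcasts, $\tau.P$, $\sigma.P$, conditionals, $X$, $\mathbf 0$, active receivers). Then $\mathrm{rcv}(\Gamma\triangleright W,c)$ holds iff $c$ is idle in $\Gamma$ and $\mathrm{rcv}(W,c)$. Transitions $\Gamma\triangleright W\xrightarrow{\lambda}W'$ are the least relation closed under: (Snd) $[\![e]\!]=v$ implies $\Gamma\triangleright c!\langle e\rangle.P\xrightarrow{c!v}\sigma^{\delta_v}.P$; (Rcv) $c$ idle in $\Gamma$ implies $\Gamma\triangleright\lfloor ?c(x).P\rfloor Q\xrightarrow{c?v}\lfloor ?c(x).P\rfloor$; (RcvIgn) $\neg\mathrm{rcv}(\Gamma\triangleright W,c)$ implies $\Gamma\triangleright W\xrightarrow{c?v}W$; (Sync) $\Gamma\triangleright W_1\xrightarrow{c!v}W_1'$ and $\Gamma\triangleright W_2\xrightarrow{c?v}W_2'$ imply $\Gamma\triangleright W_1|W_2\xrightarrow{c!v}W_1'|W_2'$, and symmetrically; (RcvPar) $\Gamma\triangleright W_i\xrightarrow{c?v}W_i'$ for $i=1,2$ imply $\Gamma\triangleright W_1|W_2\xrightarrow{c?v}W_1'|W_2'$; (TimeNil) $\Gamma\triangleright\mathbf 0\xrightarrow{\sigma}\mathbf 0$; (Sleep) $\Gamma\triangleright\sigma.P\xrightarrow{\sigma}P$; (ActRcv) $\Gamma\vdash_t c:n$, $n>1$ imply $\Gamma\triangleright\lfloor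 ?c(x).P\rfloor\xrightarrow{\sigma}\lfloor ?c(x).P\rfloor$; (EndRcv) $\Gamma\vdash_t c:1$, $\Gamma\vdash_v c:w$ imply $\Gamma\triangleright\lfloor ?c(x).P\rfloor\xrightarrow{\sigma}\{w/x\}P$; (Timeout) $c$ idle in $\Gamma$ implies $\Gamma\triangleright\lfloor ?c(x).P\rfloor Q\xrightarrow{\sigma}Q$; (RcvLate) $c$ exposed in $\Gamma$ implies $\Gamma\triangleright\lfloor ?c(x).P\rfloor Q\xrightarrow{\tau}\lfloor ?c(x).\{\mathtt{err}/x\}P\rfloor$; (Tau) $\Gamma\triangleright\tau.P\xrightarrow{\tau}P$; (Then)/(Else) $\Gamma\triangleright[b]P,Q\xrightarrow{\tau}\sigma.P$ if $[\![b]\!]_\Gamma$ is true and $\xrightarrow{\tau}\sigma.Q$ otherwise, where $[\![e_1=e_2]\!]_\Gamma$ is true iff $[\![e_1]\!]=[\![e_2]\!]$ and $[\![\mathrm{exp}(c)]\!]_\Gamma$ is true iff $c$ is exposed in $\Gamma$; (TimePar) $\Gamma\triangleright W_i\xrightarrow{\sigma}W_i'$ for $i=1,2$ imply $\Gamma\triangleright W_1|W_2\xrightarrow{\sigma}W_1'|W_2'$; (TauPar) $\Gamma\triangleright W_1\xrightarrow{\tau}W_1'$ implies $\Gamma\triangleright W_1|W_2\xrightarrow{\tau}W_1'|W_2$, and symmetrically; (Rec) $\Gamma\triangleright\{\mathrm{fix}\,X.P/X\}P\xrightarrow{\lambda}W$ implies $\Gamma\triangleright\mathrm{fix}\,X.P\xrightarrow{\lambda}W$;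 (Sum) for $\lambda\in\{\tau,c!v\}$, $\Gamma\triangleright P\xrightarrow{\lambda}W$ implies $\Gamma\triangleright P+Q\xrightarrow{\lambda}W$, and symmetrically; (SumTime) $\Gamma\triangleright P\xrightarrow{\sigma}P'$, $\Gamma\triangleright Q\xrightarrow{\sigma}Q'$ imply $\Gamma\triangleright P+Q\xrightarrow{\sigma}P'+Q'$; (SumRcv) $\Gamma\triangleright P\xrightarrow{c?v}W$ and $\mathrm{rcv}(\Gamma\triangleright P,c)$ imply $\Gamma\triangleright P+Q\xrightarrow{c?v}W$, and symmetrically; (ResI) $\Gamma[c\mapsto(n,v)]\triangleright W\xrightarrow{c!w}W'$ implies $\Gamma\triangleright\nu c{:}(n,v).W\xrightarrow{\tau}\nu c{:}(c!w(\Gamma[c\mapsto(n,v)]))(c).W'$; (ResV) $\Gamma[c\mapsto(n,v)]\triangleright W\xrightarrow{\lambda}W'$ with $c$ not occurring in $\lambda$ implies $\Gamma\triangleright\nu c{:}(n,v).W\xrightarrow{\lambda}\nu c{:}(\lambda(\Gamma[c\mapsto(n,v)]))(c).W'$. Reductions. $\Gamma\triangleright W\to\Gamma'\triangleright W'$ iff $\Gamma\triangleright W\xrightarrow{\lambda}W'$ for some $\lambda\in\{c!v,\sigma,\tau\}$ and $\Gamma'=\lambda(\Gamma)$; it is instantaneous ($\to_i$) if $\lambda\neq\sigma$ and timed ($\to_\sigma$) if $\lambda=\sigma$. Extensional semantics. Extensional actions $\alpha\in\{c?v,\sigma,\tau,\gamma(c,v),\iota(c)\}$ between configurations are given by: (Input)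 $\Gamma\triangleright W\xrightarrow{c?v}W'$ implies $\Gamma\triangleright W\overset{c?v}{\rightarrowtail}c?v(\Gamma)\triangleright W'$; (Time) $\Gamma\triangleright W\xrightarrow{\sigma}W'$ implies $\Gamma\triangleright W\overset{\sigma}{\rightarrowtail}\sigma(\Gamma)\triangleright W'$; (Shh) $\Gamma\triangleright W\xrightarrow{c!v}W'$ implies $\Gamma\triangleright W\overset{\tau}{\rightarrowtail}c!v(\Gamma)\triangleright W'$; (TauExt) $\Gamma\triangleright W\xrightarrow{\tau}W'$ implies $\Gamma\triangleright W\overset{\tau}{\rightarrowtail}\Gamma\triangleright W'$; (Deliver) $\Gamma(c)=(1,v)$ and $\Gamma\triangleright W\xrightarrow{\sigma}W'$ imply $\Gamma\triangleright W\overset{\gamma(c,v)}{\rightarrowtail}\sigma(\Gamma)\triangleright W'$; (Idle) $c$ idle in $\Gamma$ implies $\Gamma\triangleright W\overset{\iota(c)}{\rightarrowtail}\Gamma\triangleright W$. Weak actions: $\Rightarrow$ is the reflexive-transitive closure of $\overset{\tau}{\rightarrowtail}$; $\overset{\alpha}{\Rightarrow}$ is $\Rightarrow\overset{\alpha}{\rightarrowtail}\Rightarrow$; $\overset{\hat\alpha}{\Rightarrow}$ is $\Rightarrow$ if $\alpha=\tau$ and $\overset{\alpha}{\Rightarrow}$ otherwise. A relation $\mathcal R$ on configurations is a bisimulation if whenever $\mathcal C_1\mathcal R\mathcal C_2$ and $\mathcal C_1\overset{\alpha}{\rightarrowtail}\mathcal C_1'$ there is $\mathcal C_2'$ with $\mathcal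 C_2\overset{\hat\alpha}{\Rightarrow}\mathcal C_2'$ and $\mathcal C_1'\mathcal R\mathcal C_2'$, and symmetrically for moves of $\mathcal C_2$. Bisimilarity $\approx$ is the union of all bisimulations. Reduction barbed congruence. $\Gamma\triangleright W\downarrow_c$ iff $c$ is exposed in $\Gamma$; $\mathcal C\Downarrow_c$ iff $\mathcal C\to^*\mathcal C'$ for some $\mathcal C'$ with $\mathcal C'\downarrow_c$. A relation $\mathcal R$ on configurations is barb preserving if $\mathcal C_1\mathcal R\mathcal C_2$ and $\mathcal C_1\Downarrow_c$ imply $\mathcal C_2\Downarrow_c$; reduction closed if $\mathcal C_1\mathcal R\mathcal C_2$ and $\mathcal C_1\to\mathcal C_1'$ imply $\mathcal C_2\to^*\mathcal C_2'$ for some $\mathcal C_2'$ with $\mathcal C_1'\mathcal R\mathcal C_2'$; contextual if $(\Gamma_1\triangleright W_1)\mathcal R(\Gamma_2\triangleright W_2)$ implies $(\Gamma_1\triangleright W_1|W)\mathcal R(\Gamma_2\triangleright W_2|W)$ for every closed system term $W$. Reduction barbed congruence $\simeq$ is the largest symmetric relation on configurations that is barb preserving, reduction closed and contextual. Well-formedness. The set of well-formed configurations is the least set such that: $\Gamma\triangleright P$ is well-formed for every closed process $P$; $\Gamma\triangleright\lfloor ?c(x).P\rfloor$ is well-formed whenever $c$ is exposed in $\Gamma$; $\Gamma\triangleright W_1|W_2$ is well-formed whenever $\Gamma\triangleright W_1$ and $\Gamma\triangleright W_2$ are; $\Gamma\triangleright\nu c{:}(n,v).W$ is well-formed whenever $\Gamma[c\mapsto(n,v)]\triangleright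 W$ is. *)

(* Defs.v *)
(* CCCP: syntax, intensional and extensional semantics,
   reduction barbed congruence, bisimilarity, well-formedness.
   Binders are represented with de Bruijn indices (this realises
   "terms identified up to alpha-conversion"):
   - data variables: index bound by receivers / active receivers;
   - process variables: index bound by fix;
   - channels: natural numbers, index 0 bound by the nearest nu;
     a channel environment is a total map nat -> nat * (closed value),
     and going under nu c:(n,v) conses (n,v) onto it. *)
From Stdlib Require Import Arith List Relations.
Import ListNotations.

(* The parameters of the calculus: closed values (with err and the
   transmission times delta_v >= 1) and the expression language
   (operators on closed values). *)
Record CCCP := {
  Val : Type;
  err : Val;
  delta : Val -> nat;
  delta_pos : forall v, 1 <= delta v;
  Op : Type;
  op_eval : Op -> list Val -> Val
}.

Section CCCP_def.
Variable Sg : CCCP.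

Definition chan := nat.

Inductive value : Type :=
| VVar (i : nat)
| VCl (v : Val Sg).

Inductive exp : Type :=
| EVal (w : value)
| EOp (f : Op Sg) (args : list exp).

Inductive bexp : Type :=
| BEq (e1 e2 : exp)
| BExp (c : chan).

Inductive proc : Type :=
| PSnd (c : chan) (e : exp) (P : proc)
| PRcv (c : chan) (P : proc) (Q : proc)       (* |_?c(x).P_|Q, x bound in P *)
| PSigma (P : proc)
| PTau (P : proc)
| PSum (P Q : proc)
| PIf (b : bexp) (P Q : proc)
| PVar (X : nat)
| PNil
| PFix (P : proc).                            (* fix X.P, X bound in P *)

Inductive sys : Type :=
| SProc (P : proc)
| SActRcv (c : chan) (P : proc)               (* |_?c(x).P_|, x bound in P *)
| SPar (W1 W2 : sys)
| SRes (n : nat) (v : Val Sg) (W : sys).       (* nu c:(n,v).W, c bound *)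

Fixpoint eval (e : exp) : option (Val Sg) :=
  match e with
  | EVal (VCl v) => Some v
  | EVal (VVar _) => None
  | EOp f args =>
      let fix evals (l : list exp) : option (list (Val Sg)) :=
        match l with
        | nil => Some nil
        | e :: l => match eval e, evals l with
                    | Some v, Some vs => Some (v :: vs)
                    | _, _ => None
                    end
        end in
      match evals args with
      | Some vs => Some (op_eval Sg f vs)
      | None => None
      end
  end.

Definition subst_value (k : nat) (w : Val Sg) (u : value) : value :=
  match u with
  | VVar i => if i =? k then VCl w else if k <? i then VVar (i - 1) else VVar i
  | VCl v => VCl v
  end.

Fixpoint subst_exp (k : nat) (w : Val Sg) (e : exp) : exp :=
  match e with
  | EVal u => EVal (subst_value k w u)
  | EOp f args => EOp f (map (subst_exp k w) args)
  end.

Definition subst_bexp (k : nat) (w : Val Sg) (b : bexp) : bexp :=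
  match b with
  | BEq e1 e2 => BEq (subst_exp k w e1) (subst_exp k w e2)
  | BExp c => BExp c
  end.

Fixpoint subst_proc (k : nat) (w : Val Sg) (P : proc) : proc :=
  match P with
  | PSnd c e P => PSnd c (subst_exp k w e) (subst_proc k w P)
  | PRcv c P Q => PRcv c (subst_proc (S k) w P) (subst_proc k w Q)
  | PSigma P => PSigma (subst_proc k w P)
  | PTau P => PTau (subst_proc k w P)
  | PSum P Q => PSum (subst_proc k w P) (subst_proc k w Q)
  | PIf b P Q => PIf (subst_bexp k w b) (subst_proc k w P) (subst_proc k w Q)
  | PVar X => PVar X
  | PNil => PNil
  | PFix P => PFix (subst_proc k w P)
  end.

Definition dsubst (w : Val Sg) (P : proc) : proc := subst_proc 0 w P.

(* substitution of a closed process R for process variable k *)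
Fixpoint psubst (k : nat) (R : proc) (P : proc) : proc :=
  match P with
  | PSnd c e P => PSnd c e (psubst k R P)
  | PRcv c P Q => PRcv c (psubst k R P) (psubst k R Q)
  | PSigma P => PSigma (psubst k R P)
  | PTau P => PTau (psubst k R P)
  | PSum P Q => PSum (psubst k R P) (psubst k R Q)
  | PIf b P Q => PIf b (psubst k R P) (psubst k R Q)
  | PVar X => if X =? k then R else if k <? X then PVar (X - 1) else PVar X
  | PNil => PNil
  | PFix P => PFix (psubst (S k) R P)
  end.

Definition unfold (P : proc) : proc := psubst 0 (PFix P) P.

Fixpoint sigma_n (n : nat) (P : proc) : proc :=
  match n with
  | 0 => P
  | S n => PSigma (sigma_n n P)
  end.

Definition closed_value (d : nat) (u : value) : Prop :=
  match u with VVar i => i < d | VCl _ => True end.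

Fixpoint closed_exp (d : nat) (e : exp) : Prop :=
  match e with
  | EVal u => closed_value d u
  | EOp _ args => (fix cl (l : list exp) : Prop :=
                     match l with nil => True | e :: l => closed_exp d e /\ cl l end) args
  end.

Definition closed_bexp (d : nat) (b : bexp) : Prop :=
  match b with BEq e1 e2 => closed_exp d e1 /\ closed_exp d e2 | BExp _ => True end.

Fixpoint closed_proc (dv dp : nat) (P : proc) : Prop :=
  match P with
  | PSnd _ e P => closed_exp dv e /\ closed_proc dv dp P
  | PRcv _ P Q => closed_proc (S dv) dp P /\ closed_proc dv dp Q
  | PSigma P | PTau P => closed_proc dv dp P
  | PSum P Q => closed_proc dv dp P /\ closed_proc dv dp Q
  | PIf b P Q => closed_bexp dv b /\ closed_proc dv dp P /\ closed_proc dv dp Q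
  | PVar X => X < dp
  | PNil => True
  | PFix P => closed_proc dv (S dp) P
  end.

Fixpoint guarded (k : nat) (P : proc) : Prop :=
  match P with
  | PSnd _ _ _ | PRcv _ _ _ | PSigma _ | PIf _ _ _ | PNil => True
  | PTau P => guarded k P
  | PSum P Q => guarded k P /\ guarded k Q
  | PVar X => X <> k
  | PFix P => guarded (S k) P
  end.

Fixpoint proc_ok (P : proc) : Prop :=
  match P with
  | PSnd _ _ P | PSigma P | PTau P => proc_ok P
  | PRcv _ P Q | PSum P Q | PIf _ P Q => proc_ok P /\ proc_ok Q
  | PVar _ | PNil => True
  | PFix P => guarded 0 P /\ proc_ok P
  end.

Fixpoint closed_sys (W : sys) : Prop :=
  match W with
  | SProc P => closed_proc 0 0 P /\ proc_ok P
  | SActRcv _ P => closed_proc 1 0 P /\ proc_ok P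
  | SPar W1 W2 => closed_sys W1 /\ closed_sys W2
  | SRes _ _ W => closed_sys W
  end.

Definition env := chan -> nat * Val Sg.
Definition config := (env * sys)%type.

Definition env_cons (p : nat * Val Sg) (G : env) : env :=
  fun k => match k with 0 => p | S k => G k end.

Definition idle (G : env) (c : chan) : Prop := fst (G c) = 0.
Definition exposed (G : env) (c : chan) : Prop := fst (G c) <> 0.

Definition env_upd (G : env) (c : chan) (p : nat * Val Sg) : env :=
  fun k => if k =? c then p else G k.

Inductive act : Type :=
| ASnd (c : chan) (v : Val Sg)
| ARcv (c : chan) (v : Val Sg)
| ASigma
| ATau.

Definition bcast_env (c : chan) (v : Val Sg) (G : env) : env :=
  env_upd G c (match G c with
               | (0, _) => (delta Sg v, v)
               | (n, _) => (Nat.max (delta Sg v) n, err Sg)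
               end).

Definition act_env (l : act) (G : env) : env :=
  match l with
  | ASigma => fun k => let (n, w) := G k in (n - 1, w)
  | ASnd c v => bcast_env c v G
  | ARcv c v => bcast_env c v G
  | ATau => G
  end.

(* an action seen from under one nu: channels shifted by one *)
Definition shift_act (l : act) : act :=
  match l with
  | ASnd c v => ASnd (S c) v
  | ARcv c v => ARcv (S c) v
  | ASigma => ASigma
  | ATau => ATau
  end.

Fixpoint rcv_proc (P : proc) (c : chan) : Prop :=
  match P with
  | PRcv d _ _ => d = c
  | PSum P Q => rcv_proc P c \/ rcv_proc Q c
  | PFix P => rcv_proc P c
  | _ => False
  end.

Fixpoint rcv_sys (W : sys) (c : chan) : Prop :=
  match W with
  | SProc P => rcv_proc P c
  | SActRcv _ _ => False
  | SPar W1 W2 => rcv_sys W1 c \/ rcv_sys W2 c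
  | SRes _ _ W => rcv_sys W (S c)
  end.

Definition rcv (G : env) (W : sys) (c : chan) : Prop := idle G c /\ rcv_sys W c.

Definition beval (G : env) (b : bexp) (t : bool) : Prop :=
  match b with
  | BEq e1 e2 => exists v1 v2, eval e1 = Some v1 /\ eval e2 = Some v2 /\
                               (v1 = v2 <-> t = true)
  | BExp c => exposed G c <-> t = true
  end.

Inductive trans : env -> sys -> act -> sys -> Prop :=
| TSnd G c e P v : eval e = Some v ->
    trans G (SProc (PSnd c e P)) (ASnd c v) (SProc (sigma_n (delta Sg v) P))
| TRcv G c P Q v : idle G c ->
    trans G (SProc (PRcv c P Q)) (ARcv c v) (SActRcv c P)
| TRcvIgn G W c v : ~ rcv G W c -> trans G W (ARcv c v) W
| TSyncL G W1 W2 W1' W2' c v : trans G W1 (ASnd c v) W1' -> trans G W2 (ARcv c v) W2' ->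
    trans G (SPar W1 W2) (ASnd c v) (SPar W1' W2')
| TSyncR G W1 W2 W1' W2' c v : trans G W1 (ARcv c v) W1' -> trans G W2 (ASnd c v) W2' ->
    trans G (SPar W1 W2) (ASnd c v) (SPar W1' W2')
| TRcvPar G W1 W2 W1' W2' c v : trans G W1 (ARcv c v) W1' -> trans G W2 (ARcv c v) W2' ->
    trans G (SPar W1 W2) (ARcv c v) (SPar W1' W2')
| TTimeNil G : trans G (SProc PNil) ASigma (SProc PNil)
| TSleep G P : trans G (SProc (PSigma P)) ASigma (SProc P)
| TActRcv G c P n w : G c = (n, w) -> 1 < n ->
    trans G (SActRcv c P) ASigma (SActRcv c P)
| TEndRcv G c P w : G c = (1, w) -> trans G (SActRcv c P) ASigma (SProc (dsubst w P))
| TTimeout G c P Q : idle G c -> trans G (SProc (PRcv c P Q)) ASigma (SProc Q)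
| TRcvLate G c P Q : exposed G c ->
    trans G (SProc (PRcv c P Q)) ATau (SActRcv c (dsubst (err Sg) P))
| TTau G P : trans G (SProc (PTau P)) ATau (SProc P)
| TThen G b P Q : beval G b true -> trans G (SProc (PIf b P Q)) ATau (SProc (PSigma P))
| TElse G b P Q : beval G b false -> trans G (SProc (PIf b P Q)) ATau (SProc (PSigma Q))
| TTimePar G W1 W2 W1' W2' : trans G W1 ASigma W1' -> trans G W2 ASigma W2' ->
    trans G (SPar W1 W2) ASigma (SPar W1' W2')
| TTauParL G W1 W2 W1' : trans G W1 ATau W1' -> trans G (SPar W1 W2) ATau (SPar W1' W2)
| TTauParR G W1 W2 W2' : trans G W2 ATau W2' -> trans G (SPar W1 W2) ATau (SPar W1 W2')
| TRec G P l W : trans G (SProc (unfold P)) l W -> trans G (SProc (PFix P)) l W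
| TSumL G P Q l W : (l = ATau \/ exists c v, l = ASnd c v) ->
    trans G (SProc P) l W -> trans G (SProc (PSum P Q)) l W
| TSumR G P Q l W : (l = ATau \/ exists c v, l = ASnd c v) ->
    trans G (SProc Q) l W -> trans G (SProc (PSum P Q)) l W
| TSumTime G P Q P' Q' : trans G (SProc P) ASigma (SProc P') ->
    trans G (SProc Q) ASigma (SProc Q') ->
    trans G (SProc (PSum P Q)) ASigma (SProc (PSum P' Q'))
| TSumRcvL G P Q c v W : trans G (SProc P) (ARcv c v) W -> rcv G (SProc P) c ->
    trans G (SProc (PSum P Q)) (ARcv c v) W
| TSumRcvR G P Q c v W : trans G (SProc Q) (ARcv c v) W -> rcv G (SProc Q) c ->
    trans G (SProc (PSum P Q)) (ARcv c v) W
| TResI G n v W w W' : trans (env_cons (n, v) G) W (ASnd 0 w) W' ->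
    trans G (SRes n v W) ATau
      (let (n', v') := act_env (ASnd 0 w) (env_cons (n, v) G) 0 in SRes n' v' W')
| TResV G n v W l W' : trans (env_cons (n, v) G) W (shift_act l) W' ->
    trans G (SRes n v W) l
      (let (n', v') := act_env (shift_act l) (env_cons (n, v) G) 0 in SRes n' v' W').

Definition is_config (C : config) : Prop := closed_sys (snd C).

Definition red (C C' : config) : Prop :=
  exists l W', (forall c v, l <> ARcv c v) /\
    trans (fst C) (snd C) l W' /\ C' = (act_env l (fst C), W').

Definition red_star := clos_refl_trans config red.

Definition barb (C : config) (c : chan) : Prop := exposed (fst C) c.
Definition wbarb (C : config) (c : chan) : Prop :=
  exists C', red_star C C' /\ barb C' c.

Definition barb_preserving (R : config -> config -> Prop) : Prop :=
  forall C1 C2 c, R C1 C2 -> wbarb C1 c -> wbarb C2 c.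

Definition reduction_closed (R : config -> config -> Prop) : Prop :=
  forall C1 C2 C1', R C1 C2 -> red C1 C1' -> exists C2', red_star C2 C2' /\ R C1' C2'.

Definition contextual (R : config -> config -> Prop) : Prop :=
  forall G1 W1 G2 W2 W, R (G1, W1) (G2, W2) -> closed_sys W ->
    R (G1, SPar W1 W) (G2, SPar W2 W).

(* the largest symmetric, barb preserving, reduction closed, contextual
   relation on configurations = union of all such relations *)
Definition rbc (C1 C2 : config) : Prop :=
  exists R : config -> config -> Prop,
    (forall D1 D2, R D1 D2 -> is_config D1 /\ is_config D2) /\
    (forall D1 D2, R D1 D2 -> R D2 D1) /\
    barb_preserving R /\ reduction_closed R /\ contextual R /\ R C1 C2.

Inductive eact : Type :=
| EIn (c : chan) (v : Val Sg)
| ESigma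
| ETau
| EGamma (c : chan) (v : Val Sg)
| EIota (c : chan).

Inductive ext : config -> eact -> config -> Prop :=
| XInput G W W' c v : trans G W (ARcv c v) W' ->
    ext (G, W) (EIn c v) (act_env (ARcv c v) G, W')
| XTime G W W' : trans G W ASigma W' -> ext (G, W) ESigma (act_env ASigma G, W')
| XShh G W W' c v : trans G W (ASnd c v) W' -> ext (G, W) ETau (act_env (ASnd c v) G, W')
| XTau G W W' : trans G W ATau W' -> ext (G, W) ETau (G, W')
| XDeliver G W W' c v : G c = (1, v) -> trans G W ASigma W' ->
    ext (G, W) (EGamma c v) (act_env ASigma G, W')
| XIdle G W c : idle G c -> ext (G, W) (EIota c) (G, W).

Definition tau_star := clos_refl_trans config (fun C C' => ext C ETau C').

Definition weak (C : config) (a : eact) (C' : config) : Prop :=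
  exists D D', tau_star C D /\ ext D a D' /\ tau_star D' C'.

Definition weak_hat (C : config) (a : eact) (C' : config) : Prop :=
  match a with
  | ETau => tau_star C C'
  | _ => weak C a C'
  end.

Definition bisimulation (R : config -> config -> Prop) : Prop :=
  forall C1 C2, R C1 C2 ->
    (forall a C1', ext C1 a C1' -> exists C2', weak_hat C2 a C2' /\ R C1' C2') /\
    (forall a C2', ext C2 a C2' -> exists C1', weak_hat C1 a C1' /\ R C1' C2').

Definition bisimilar (C1 C2 : config) : Prop :=
  exists R, bisimulation R /\ R C1 C2.

Fixpoint wf_sys (G : env) (W : sys) : Prop :=
  match W with
  | SProc _ => True
  | SActRcv c _ => exposed G c
  | SPar W1 W2 => wf_sys G W1 /\ wf_sys G W2
  | SRes n v W => wf_sys (env_cons (n, v) G) W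
  end.

Definition well_formed (C : config) : Prop := is_config C /\ wf_sys (fst C) (snd C).

End CCCP_def.

(* Main.v *)
(* A congruent pair is put in parallel with testers built from [choice f],
   i.e. [tau.A + tau.0] with [A] broadcasting forever on a fresh channel [f]: it
   blocks time until it commits, and its three states (uncommitted, [A], [0]) are
   told apart by weak barbs, since every well-formed configuration lets time pass and
   so a channel used only finitely often eventually stays idle even if all channels
   are exposed at first.  An answer to a move must therefore leave the testers in the
   prescribed state, which pins down how much time passed and which of input,
   broadcast, delivery or exposure happened.  This leaves uncommitted testers beside
   the answer.  They cannot be discarded inside congruence, whose contexts may use
   their channels and need not be well-formed; instead, configurations congruent
   next to such testers are shown to be related by a bisimilarity that is finer than
   the given one and is itself preserved by all parallel contexts, hence contained in
   congruence. *)
Require Import Defs.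
From Stdlib Require Import Arith List Relations Lia Classical FunctionalExtensionality.

(** Reduction closure by itself allows an instantaneous move to be answered by reductions during
    which time passes, and it says nothing about inputs, so a context has to force both. A tester
    can do so only by stopping time while it waits, and its outcomes are separated by barbs only
    once time runs again. An active receiver on an idle channel, which an ill-formed context may
    contain, would stop time for good; hence well-formedness accompanies every argument about
    testers. The refinement of bisimilarity rests on idleness. If related configurations agree on
    which channels are idle, the answer to an instantaneous move can expose only the channel exposed
    by the move itself; all its other broadcasts collide on channels already exposed, where a
    parallel component is free to ignore them. This is what lets the component follow the answer. *)

Section Completeness.
Variable Sg : CCCP.

Arguments VVar {Sg}. Arguments VCl {Sg}. Arguments EVal {Sg}. Arguments EOp {Sg}.
Arguments BEq {Sg}. Arguments BExp {Sg}.
Arguments PSnd {Sg}. Arguments PRcv {Sg}. Arguments PSigma {Sg}. Arguments PTau {Sg}.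
Arguments PSum {Sg}. Arguments PIf {Sg}. Arguments PVar {Sg}. Arguments PNil {Sg}.
Arguments PFix {Sg}.
Arguments SProc {Sg}. Arguments SActRcv {Sg}. Arguments SPar {Sg}. Arguments SRes {Sg}.
Arguments eval {Sg}. Arguments subst_exp {Sg}.
Arguments subst_proc {Sg}. Arguments dsubst {Sg}.
Arguments psubst {Sg}. Arguments unfold {Sg}. Arguments sigma_n {Sg}.
Arguments closed_exp {Sg}. Arguments closed_bexp {Sg}. Arguments closed_proc {Sg}.
Arguments guarded {Sg}. Arguments proc_ok {Sg}. Arguments closed_sys {Sg}.
Arguments env_cons {Sg}. Arguments idle {Sg}. Arguments exposed {Sg}. Arguments env_upd {Sg}.
Arguments ASnd {Sg}. Arguments ARcv {Sg}. Arguments ASigma {Sg}. Arguments ATau {Sg}.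
Arguments bcast_env {Sg}. Arguments act_env {Sg}. Arguments shift_act {Sg}.
Arguments rcv_proc {Sg}. Arguments rcv_sys {Sg}. Arguments rcv {Sg}. Arguments beval {Sg}.
Arguments trans {Sg}. Arguments red {Sg}. Arguments red_star {Sg}. Arguments wbarb {Sg}.
Arguments barb {Sg}. Arguments is_config {Sg}.
Arguments ETau {Sg}. Arguments ext {Sg}. Arguments tau_star {Sg}. Arguments wf_sys {Sg}.
Arguments rbc {Sg}. Arguments well_formed {Sg}.

Implicit Types (G H : env Sg) (P Q R : proc Sg) (W V X Y K J : sys Sg) (C D E : config Sg)
  (l : act Sg).

(** * Closed terms, guardedness and substitution *)

Lemma closed_exp_op d f args :
  closed_exp (Sg:=Sg) d (EOp f args) <-> Forall (closed_exp d) args.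
Proof.
  simpl; induction args as [|e args IH]; [split; auto|].
  split; [intros [He Ha]; constructor; tauto|].
  intros Ha; inversion Ha; subst; tauto.
Qed.

Lemma closed_exp_subst d w : forall e : exp Sg,
  closed_exp (S d) e -> closed_exp d (subst_exp d w e).
Proof.
  fix IH 1; intros [[i|v]|f args] He.
  - simpl in *; destruct (Nat.eqb_spec i d); [exact I|].
    destruct (Nat.ltb_spec d i); simpl; lia.
  - exact I.
  - apply closed_exp_op in He; simpl subst_exp; apply closed_exp_op.
    induction args as [|e args IHa]; simpl; constructor.
    + apply IH; inversion He; assumption.
    + apply IHa; inversion He; assumption.
Qed.

Lemma closed_exp_mono d d' : d <= d' -> forall e : exp Sg, closed_exp d e -> closed_exp d' e.
Proof.
  intros Hd; fix IH 1; intros [[i|v]|f args] He.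
  - simpl in *; lia.
  - exact I.
  - apply closed_exp_op in He; apply closed_exp_op.
    induction args as [|e args IHa]; constructor.
    + apply IH; inversion He; assumption.
    + apply IHa; inversion He; assumption.
Qed.

Lemma eval_closed : forall e : exp Sg, closed_exp 0 e -> exists v, eval e = Some v.
Proof.
  fix IH 1; intros [[i|v]|f args] He.
  - simpl in He; lia.
  - exists v; reflexivity.
  - apply closed_exp_op in He.
    simpl; set (evals := fix evals (l : list (exp Sg)) := match l with nil => Some nil | _ => _ end).
    enough (exists vs, evals args = Some vs) as [vs ->] by eauto.
    induction args as [|e args IHa]; [simpl; eauto|].
    destruct (IH e) as [v Hv]; [inversion He; assumption|].
    destruct IHa as [vs Hvs]; [inversion He; assumption|].
    simpl; rewrite Hv, Hvs; eauto.
Qed.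

Lemma closed_proc_mono P : forall dv dv' dp dp', dv <= dv' -> dp <= dp' ->
  closed_proc dv dp P -> closed_proc dv' dp' P.
Proof.
  induction P; simpl; intros dv dv' dp dp' Hv Hp HP;
    repeat match goal with h : _ /\ _ |- _ => destruct h end;
    repeat match goal with |- _ /\ _ => split end;
    try exact I;
    try (match goal with h : forall dv dv' dp dp' : nat, _ |- _ => eapply h; [| |eassumption]; lia end);
    try (eapply IHP1; [| |eassumption]; lia);
    try (eapply IHP2; [| |eassumption]; lia);
    try (eapply closed_exp_mono; [|eassumption]; lia).
  - destruct b; simpl in *; [|exact I].
    split; (eapply closed_exp_mono; [|apply H]; lia).
  - lia.
Qed.

Lemma closed_proc_subst P w : forall k dp,
  closed_proc (S k) dp P -> closed_proc k dp (subst_proc k w P).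
Proof.
  induction P; simpl; intros k dp HP;
    repeat match goal with h : _ /\ _ |- _ => destruct h end;
    repeat match goal with |- _ /\ _ => split end;
    auto using closed_exp_subst.
  destruct b; simpl in *; [|exact I].
  split; apply closed_exp_subst; tauto.
Qed.

Lemma guarded_subst P w : forall k j, guarded j P -> guarded j (subst_proc k w P).
Proof. induction P; simpl; intros k j HP; firstorder. Qed.

Lemma proc_ok_subst P w : forall k, proc_ok P -> proc_ok (subst_proc k w P).
Proof.
  induction P; simpl; intros k HP; firstorder; auto using guarded_subst.
Qed.

Lemma guarded_closed P : forall dv dp k, closed_proc dv dp P -> dp <= k -> guarded k P.
Proof.
  induction P; simpl; intros dv dp k HP Hk; auto.
  - eapply IHP; eauto.
  - destruct HP; split; [eapply IHP1|eapply IHP2]; eauto.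
  - lia.
  - eapply IHP; [eassumption|lia].
Qed.

Lemma guarded_psubst P R : closed_proc 0 0 R -> forall j k, j < k ->
  guarded j P -> guarded j (psubst k R P).
Proof.
  intros HR; induction P; simpl; intros j k Hj HP; auto.
  - destruct HP; split; auto.
  - destruct (Nat.eqb_spec X k); [eapply guarded_closed; [eassumption|lia]|].
    destruct (Nat.ltb_spec k X); simpl; lia.
  - apply IHP; [lia|assumption].
Qed.

Lemma proc_ok_psubst P R : closed_proc 0 0 R -> proc_ok R ->
  forall k, proc_ok P -> proc_ok (psubst k R P).
Proof.
  intros HR HR'; induction P; simpl; intros k HP; firstorder.
  - destruct (X =? k); [assumption|]; destruct (k <? X); exact I.
  - apply guarded_psubst; [assumption|lia|assumption].
Qed.

Lemma closed_psubst P R : closed_proc 0 0 R -> forall dv k,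
  closed_proc dv (S k) P -> closed_proc dv k (psubst k R P).
Proof.
  intros HR; induction P; simpl; intros dv k HP; firstorder.
  destruct (Nat.eqb_spec X k); [eapply closed_proc_mono; [| |eassumption]; lia|].
  destruct (Nat.ltb_spec k X); simpl; lia.
Qed.

Lemma closed_unfold P : closed_sys (SProc (PFix P)) -> closed_sys (SProc (unfold P)).
Proof.
  simpl; intros [HP [Hg Hok]]; unfold Defs.unfold; split.
  - apply closed_psubst; assumption.
  - apply proc_ok_psubst; simpl; auto.
Qed.

Lemma closed_sigma_n n P : closed_sys (SProc P) -> closed_sys (SProc (sigma_n n P)).
Proof. induction n; simpl; auto. Qed.

Lemma closed_dsubst w P : closed_proc 1 0 P -> proc_ok P -> closed_sys (SProc (dsubst w P)).
Proof. split; [apply closed_proc_subst|apply proc_ok_subst]; assumption. Qed.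

Lemma trans_closed G W l W' : trans G W l W' -> closed_sys W -> closed_sys W'.
Proof.
  induction 1; intros Hc;
    try (match goal with |- closed_sys (SProc (sigma_n _ _)) => apply closed_sigma_n end);
    try (match goal with |- closed_sys (SProc (dsubst _ _)) => apply closed_dsubst end);
    try (destruct (act_env _ _ _));
    try (apply IHtrans, closed_unfold, Hc);
    simpl in *; firstorder.
  - eapply closed_proc_mono with (dv := 0); [lia|reflexivity|].
    apply closed_proc_subst; assumption.
  - apply proc_ok_subst; assumption.
Qed.

(** * Guarded recursion, input enabledness and maximal progress *)

Definition inst l : Prop := l = ATau \/ exists c v, l = ASnd c v.

(** A guarded variable does not occur in the positions that [rcv_proc] inspects. The same holds for
    [height] and [load] below, which is why unfolding a recursion preserves all three. *)
Lemma rcv_psubst P R c : forall k, guarded k P -> (rcv_proc (psubst k R P) c <-> rcv_proc P c).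
Proof.
  induction P; simpl; intros k HP; try tauto.
  - destruct HP as [H1 H2]; rewrite (IHP1 k H1), (IHP2 k H2); tauto.
  - destruct (Nat.eqb_spec X k); [contradiction|]; destruct (k <? X); simpl; tauto.
  - apply IHP, HP.
Qed.

Lemma rcv_unfold P c : guarded 0 P -> (rcv_proc (unfold P) c <-> rcv_proc P c).
Proof. apply rcv_psubst. Qed.

(* Number of nested sums and recursions above the first guard; unfolding a
   guarded recursion decreases it, which makes it an induction measure. *)
Fixpoint height P : nat :=
  match P with
  | PSum P Q => S (Nat.max (height P) (height Q))
  | PFix P => S (height P)
  | _ => 0
  end.

(* Bounds the number of instantaneous steps a process can do before time passes. *)
Fixpoint load P : nat :=
  match P with
  | PSnd _ _ _ | PRcv _ _ _ | PIf _ _ _ => 1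
  | PTau P => S (load P)
  | PSum P Q => load P + load Q
  | PFix P => load P
  | _ => 0
  end.

Fixpoint load_sys W : nat :=
  match W with
  | SProc P => load P
  | SActRcv _ _ => 0
  | SPar W1 W2 => load_sys W1 + load_sys W2
  | SRes _ _ W => load_sys W
  end.

Lemma height_psubst P R : forall k, guarded k P -> height (psubst k R P) = height P.
Proof.
  induction P; simpl; intros k HP; auto.
  - destruct HP; auto.
  - destruct (Nat.eqb_spec X k); [contradiction|]; destruct (k <? X); reflexivity.
Qed.

Lemma load_psubst P R : forall k, guarded k P -> load (psubst k R P) = load P.
Proof.
  induction P; simpl; intros k HP; auto.
  - destruct HP; auto.
  - destruct (Nat.eqb_spec X k); [contradiction|]; destruct (k <? X); reflexivity.
Qed.

(** Broadcasts and conditionals leave a continuation behind a delay, of load 0 because [delta] is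
    positive; reception leaves an active receiver, also of load 0; a [tau]-prefix loses its own
    unit. *)
Lemma load_trans G W l W' : trans G W l W' -> closed_sys W ->
  match l with
  | ASigma => True
  | ARcv _ _ => load_sys W' <= load_sys W
  | _ => load_sys W' < load_sys W
  end.
Proof.
  induction 1; intros Hc; try (specialize (IHtrans (closed_unfold _ Hc))); simpl in *;
    try exact I; try lia;
    try (destruct Hc as [Hc1 Hc2]; specialize (IHtrans1 Hc1); specialize (IHtrans2 Hc2); lia);
    try (specialize (IHtrans ltac:(tauto)); lia).
  - pose proof (delta_pos Sg v); destruct (delta Sg v); simpl; lia.
  - unfold Defs.unfold in IHtrans; rewrite load_psubst in IHtrans by tauto.
    exact IHtrans.
  - specialize (IHtrans ltac:(tauto)).
    destruct H as [->|[? [? ->]]]; lia.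
  - specialize (IHtrans ltac:(tauto)).
    destruct H as [->|[? [? ->]]]; lia.
  - specialize (IHtrans Hc); destruct n; exact IHtrans.
  - specialize (IHtrans Hc); destruct l; simpl in *; exact IHtrans.
Qed.

Lemma height_unfold P : guarded 0 P -> height (unfold P) = height P.
Proof. apply height_psubst. Qed.

(** If [P] does not listen on [c], (RcvIgn) applies; otherwise (SumRcv) descends to a listening
    summand, and (Rec) to an unfolding of smaller [height]. *)
Lemma input_enabled_proc G c v : forall P, closed_sys (SProc P) ->
  exists W', trans G (SProc P) (ARcv c v) W'.
Proof.
  intros P; remember (height P) as n eqn:Hn; revert P Hn.
  induction n as [n IH] using lt_wf_ind; intros P -> Hc.
  destruct (classic (rcv G (SProc P) c)) as [[Hi Hr]|Hr];
    [|exists (SProc P); constructor; assumption].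
  destruct P as [| | | |P Q| | | |P]; simpl in Hr; try contradiction.
  - subst; eexists; apply TRcv; assumption.
  - simpl in Hc; destruct Hr as [Hr|Hr].
    + destruct (IH (height P)) with (P := P) as [W' HW]; simpl; try tauto; try lia.
      exists W'; apply TSumRcvL; [|split]; assumption.
    + destruct (IH (height Q)) with (P := Q) as [W' HW]; simpl; try tauto; try lia.
      exists W'; apply TSumRcvR; [|split]; assumption.
  - assert (Hg : guarded 0 P) by apply Hc.
    destruct (IH (height (unfold P))) with (P := unfold P) as [W' HW]; auto.
    + rewrite height_unfold by assumption; simpl; lia.
    + apply closed_unfold, Hc.
    + exists W'; apply TRec, HW.
Qed.

Lemma input_enabled W : forall G c v, closed_sys W -> exists W', trans G W (ARcv c v) W'.
Proof.
  induction W as [P|d P|W1 IH1 W2 IH2|n u W IH]; intros G c v Hc.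
  - apply input_enabled_proc, Hc.
  - exists (SActRcv d P); constructor; intros [_ []].
  - destruct Hc as [Hc1 Hc2].
    destruct (IH1 G c v Hc1) as [W1' H1], (IH2 G c v Hc2) as [W2' H2].
    exists (SPar W1' W2'); constructor; assumption.
  - destruct (IH (env_cons (n, u) G) (S c) v Hc) as [W' HW].
    eexists; apply TResV with (l := ARcv c v); eassumption.
Qed.

Lemma beval_total G b : closed_bexp 0 b -> beval G b true \/ beval G b false.
Proof.
  destruct b as [e1 e2|c]; simpl.
  - intros [H1 H2]; apply eval_closed in H1 as [v1 H1], H2 as [v2 H2].
    destruct (classic (v1 = v2)) as [He|He]; [left|right]; exists v1, v2;
      repeat split; auto; congruence.
  - intros _; destruct (classic (exposed G c)); [left|right]; split; auto; congruence.
Qed.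

Lemma progress_proc G : forall P, closed_sys (SProc P) ->
  (exists l W', inst l /\ trans G (SProc P) l W') \/
  (exists P', trans G (SProc P) ASigma (SProc P')).
Proof.
  intros P; remember (height P) as n eqn:Hn; revert P Hn.
  induction n as [n IH] using lt_wf_ind; intros P -> Hc.
  destruct P as [c e P|c P Q|P|P|P Q|b P Q|x| |P].
  - destruct Hc as [[He _] _]; apply eval_closed in He as [v Hv].
    left; do 2 eexists; split; [|apply TSnd; eassumption]; right; eauto.
  - destruct (classic (idle G c)).
    + right; eexists; apply TTimeout; assumption.
    + left; do 2 eexists; split; [|apply TRcvLate; assumption]; left; reflexivity.
  - right; eexists; apply TSleep.
  - left; do 2 eexists; split; [|apply TTau]; left; reflexivity.
  - simpl in Hc.
    destruct (IH (height P)) with (P := P) as [(l & W' & Hl & HW)|[P' HP]];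
      simpl; try tauto; try lia.
    { left; exists l, W'; split; [|apply TSumL]; assumption. }
    destruct (IH (height Q)) with (P := Q) as [(l & W' & Hl & HW)|[Q' HQ]];
      simpl; try tauto; try lia.
    { left; exists l, W'; split; [|apply TSumR]; assumption. }
    right; exists (PSum P' Q'); apply TSumTime; assumption.
  - destruct Hc as [[Hb _] _].
    left; destruct (beval_total G b Hb); do 2 eexists;
      (split; [left; reflexivity|]); [apply TThen|apply TElse]; assumption.
  - destruct Hc as [Hc _]; simpl in Hc; lia.
  - right; eexists; apply TTimeNil.
  - assert (Hg : guarded 0 P) by apply Hc.
    destruct (IH (height (unfold P))) with (P := unfold P) as [(l & W' & Hl & HW)|[P' HP]]; auto.
    + rewrite height_unfold by assumption; simpl; lia.
    + apply closed_unfold, Hc.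
    + left; exists l, W'; split; [|apply TRec]; assumption.
    + right; exists P'; apply TRec; assumption.
Qed.

(** Well-formedness enters at active receivers: on an idle channel such a receiver could not let
    time pass, nor do anything instantaneous. *)
Lemma progress W : forall G, closed_sys W -> wf_sys G W ->
  (exists l W', inst l /\ trans G W l W') \/ (exists W', trans G W ASigma W').
Proof.
  induction W as [P|c P|W1 IH1 W2 IH2|n u W IH]; intros G Hc Hw.
  - destruct (progress_proc G P Hc) as [?|[P' ?]]; eauto.
  - right; simpl in Hw; unfold exposed in Hw.
    destruct (G c) as [[|[|m]] w] eqn:HG; simpl in Hw; [contradiction| |].
    + eexists; apply TEndRcv; eassumption.
    + eexists; eapply TActRcv; [eassumption|lia].
  - destruct Hc as [Hc1 Hc2], Hw as [Hw1 Hw2].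
    destruct (IH1 G Hc1 Hw1) as [(l & W' & [->|(c & v & ->)] & HW)|[W1' H1]].
    + left; do 2 eexists; split; [|apply TTauParL; eassumption]; left; reflexivity.
    + destruct (input_enabled W2 G c v Hc2) as [W2' H2].
      left; do 2 eexists; split; [|eapply TSyncL; eassumption]; right; eauto.
    + destruct (IH2 G Hc2 Hw2) as [(l & W' & [->|(c & v & ->)] & HW)|[W2' H2]].
      * left; do 2 eexists; split; [|apply TTauParR; eassumption]; left; reflexivity.
      * destruct (input_enabled W1 G c v Hc1) as [W1'' H1'].
        left; do 2 eexists; split; [|eapply TSyncR; eassumption]; right; eauto.
      * right; eexists; apply TTimePar; eassumption.
  - destruct (IH (env_cons (n, u) G) Hc Hw) as [(l & W' & [->|(c & v & ->)] & HW)|[W' HW]].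
    + left; do 2 eexists; split; [|eapply TResV with (l := ATau); eassumption].
      left; reflexivity.
    + destruct c as [|c]; left; do 2 eexists.
      * split; [|eapply TResI; eassumption]; left; reflexivity.
      * split; [|eapply TResV with (l := ASnd c v); eassumption]; right; eauto.
    + right; eexists; eapply TResV with (l := ASigma); eassumption.
Qed.

Lemma maximal_progress G W W1 : trans G W ASigma W1 ->
  forall l W2, inst l -> ~ trans G W l W2.
Proof.
  intros Ht; remember ASigma as s eqn:Hs.
  induction Ht; intros l2 V2 Hl2 H2; try discriminate Hs; subst;
    destruct Hl2 as [->|(c2 & v2 & ->)]; inversion H2; subst;
    try (destruct l; discriminate);
    try (eapply IHHt; [reflexivity| |eassumption]; unfold inst; eauto; fail);
    try (eapply IHHt1; [reflexivity| |eassumption]; unfold inst; eauto; fail);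
    try (eapply IHHt2; [reflexivity| |eassumption]; unfold inst; eauto; fail);
    try contradiction;
    try (match goal with h : _ \/ _ |- _ => destruct h as [?|(? & ? & ?)]; discriminate end).
  eapply IHHt; [reflexivity| |eassumption]; right; simpl; eauto.
Qed.

(** * Environment updates and preservation of well-formedness *)

Lemma bcast_same c v G :
  bcast_env c v G c = match G c with
                      | (0, _) => (delta Sg v, v)
                      | (n, _) => (Nat.max (delta Sg v) n, err Sg)
                      end.
Proof. unfold bcast_env, env_upd; rewrite Nat.eqb_refl; reflexivity. Qed.

Lemma bcast_other c v G d : d <> c -> bcast_env c v G d = G d.
Proof. intros Hd; unfold bcast_env, env_upd; apply Nat.eqb_neq in Hd as ->; reflexivity. Qed.

Lemma bcast_exposed c v G : exposed (bcast_env c v G) c.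
Proof.
  unfold exposed; rewrite bcast_same; pose proof (delta_pos Sg v).
  destruct (G c) as [[|n] w]; simpl fst; lia.
Qed.

Lemma bcast_exposed_mono c v G d : exposed G d -> exposed (bcast_env c v G) d.
Proof.
  destruct (Nat.eq_dec d c) as [->|Hd]; [intros _; apply bcast_exposed|].
  unfold exposed; rewrite bcast_other; auto.
Qed.

Lemma sigma_fst G c : fst (act_env ASigma G c) = fst (G c) - 1.
Proof. simpl; destruct (G c); reflexivity. Qed.

Lemma wf_mono W : forall G H, (forall c, exposed G c -> exposed H c) ->
  wf_sys G W -> wf_sys H W.
Proof.
  induction W as [P|c P|W1 IH1 W2 IH2|n u W IH]; simpl; intros G H HGH Hw; auto.
  - destruct Hw; split; eauto.
  - eapply IH; [|eassumption]; intros [|c]; [auto|apply HGH].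
Qed.

Lemma act_env_cons l p G : act_env (shift_act l) (env_cons p G) =
  env_cons (act_env (shift_act l) (env_cons p G) 0) (act_env l G).
Proof. apply functional_extensionality; intros [|k]; destruct l; reflexivity. Qed.

Lemma bcast_env_cons w p G :
  act_env (ASnd 0 w) (env_cons p G) = env_cons (act_env (ASnd 0 w) (env_cons p G) 0) G.
Proof. apply functional_extensionality; intros [|k]; reflexivity. Qed.

Lemma trans_wf G W l W' : trans G W l W' -> wf_sys G W -> wf_sys (act_env l G) W'.
Proof.
  induction 1; intros Hw; try exact I; try (simpl in *; firstorder; fail).
  - apply bcast_exposed.
  - eapply wf_mono; [|eassumption]; intros d; apply bcast_exposed_mono.
  - simpl; unfold exposed; simpl; rewrite H; simpl; lia.
  - specialize (IHtrans Hw); rewrite bcast_env_cons in IHtrans.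
    destruct (act_env (ASnd 0 w) (env_cons (n, v) G) 0); exact IHtrans.
  - specialize (IHtrans Hw); rewrite act_env_cons in IHtrans.
    destruct (act_env (shift_act l) (env_cons (n, v) G) 0); exact IHtrans.
Qed.

(** * Counting the broadcasts on a channel *)

Fixpoint sends_proc (g : chan) P : nat :=
  match P with
  | PSnd c _ P => (if c =? g then 1 else 0) + sends_proc g P
  | PSigma P | PTau P | PFix P => sends_proc g P
  | PRcv _ P Q | PSum P Q | PIf _ P Q => sends_proc g P + sends_proc g Q
  | PVar _ | PNil => 0
  end.

Fixpoint sends (g : chan) W : nat :=
  match W with
  | SProc P | SActRcv _ P => sends_proc g P
  | SPar W1 W2 => sends g W1 + sends g W2
  | SRes _ _ W => sends (S g) W
  end.

Fixpoint mild_proc (g : chan) P : Prop :=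
  match P with
  | PSnd _ _ P | PSigma P | PTau P => mild_proc g P
  | PRcv _ P Q | PSum P Q | PIf _ P Q => mild_proc g P /\ mild_proc g Q
  | PFix P => sends_proc g P = 0
  | PVar _ | PNil => True
  end.

(* No broadcast on [g] occurs under a recursion, so only finitely many can be fired. *)
Fixpoint mild (g : chan) W : Prop :=
  match W with
  | SProc P | SActRcv _ P => mild_proc g P
  | SPar W1 W2 => mild g W1 /\ mild g W2
  | SRes _ _ W => mild (S g) W
  end.

Lemma sends_subst g w P : forall k, sends_proc g (subst_proc k w P) = sends_proc g P.
Proof. induction P; simpl; intros k; auto. Qed.

Lemma mild_subst g w P : forall k, mild_proc g P -> mild_proc g (subst_proc k w P).
Proof. induction P; simpl; intros k HP; firstorder; rewrite sends_subst; assumption. Qed.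

Lemma sends_psubst g R P : sends_proc g R = 0 ->
  forall k, sends_proc g (psubst k R P) = sends_proc g P.
Proof.
  intros HR; induction P; simpl; intros k; auto.
  destruct (X =? k); [assumption|]; destruct (k <? X); reflexivity.
Qed.

Lemma sends_0_mild g P : sends_proc g P = 0 -> mild_proc g P.
Proof.
  induction P; simpl; intros HP; auto;
    try (split; [apply IHP1|apply IHP2]; lia); try (apply IHP; lia).
Qed.

Lemma sends_sigma_n g n P : sends_proc g (sigma_n n P) = sends_proc g P.
Proof. induction n; simpl; auto. Qed.

Lemma mild_sigma_n g n P : mild_proc g P -> mild_proc g (sigma_n n P).
Proof. induction n; simpl; auto. Qed.

Lemma mild_dsubst g w P : mild_proc g P -> mild_proc g (dsubst w P).
Proof. apply mild_subst. Qed.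

Lemma sends_dsubst g w P : sends_proc g (dsubst w P) = sends_proc g P.
Proof. apply sends_subst. Qed.

(** Unfolding copies the body of a recursion, but under [mild] this body contains no broadcast on
    [g], so the syntactic occurrences bound what can still be fired. A fired prefix is consumed,
    hence the strict decrease. *)
Lemma trans_mild G W l W' : trans G W l W' -> forall g, mild g W ->
  mild g W' /\ sends g W' <= sends g W /\ (forall v, l = ASnd g v -> sends g W' < sends g W).
Proof.
  induction 1; intros g Hg;
    try (specialize (IHtrans1 g ltac:(simpl in *; tauto));
         specialize (IHtrans2 g ltac:(simpl in *; tauto));
         destruct IHtrans1 as (M1 & S1 & B1), IHtrans2 as (M2 & S2 & B2);
         split; [simpl; tauto|]; split; [simpl; lia|];
         intros u [=]; subst; try (specialize (B1 _ eq_refl)); try (specialize (B2 _ eq_refl));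
         simpl; lia).
  all: try (split; [simpl in *; auto using mild_dsubst; tauto|]; split; [|discriminate];
            simpl; rewrite ?sends_dsubst; lia).
  - simpl; rewrite sends_sigma_n; split; [apply mild_sigma_n, Hg|]; split; [lia|].
    intros u [= -> _]; rewrite Nat.eqb_refl; lia.
  - simpl in *; split; [apply mild_dsubst; tauto|].
    rewrite sends_dsubst; split; [lia|discriminate].
  - simpl in *; destruct (IHtrans g ltac:(tauto)) as (M & B & _).
    repeat split; [tauto|tauto|lia|discriminate].
  - simpl in *; destruct (IHtrans g ltac:(tauto)) as (M & B & _).
    repeat split; [tauto|tauto|lia|discriminate].
  - assert (Hs : sends_proc g (unfold P) = 0).
    { unfold Defs.unfold; rewrite sends_psubst; assumption. }
    destruct (IHtrans g (sends_0_mild _ _ Hs)) as (M & B & S).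
    simpl in *; rewrite Hs in *; repeat split; [assumption|lia|].
    intros u Hu; specialize (S u Hu); lia.
  - simpl in *; destruct (IHtrans g ltac:(tauto)) as (M & B & S).
    repeat split; [assumption|lia|]; intros u Hu; specialize (S u Hu); lia.
  - simpl in *; destruct (IHtrans g ltac:(tauto)) as (M & B & S).
    repeat split; [assumption|lia|]; intros u Hu; specialize (S u Hu); lia.
  - simpl in *; destruct (IHtrans1 g ltac:(tauto)) as (M1 & B1 & _).
    destruct (IHtrans2 g ltac:(tauto)) as (M2 & B2 & _).
    repeat split; [assumption|assumption|lia|discriminate].
  - simpl in *; destruct (IHtrans g ltac:(tauto)) as (M & B & S).
    repeat split; [assumption|lia|discriminate].
  - simpl in *; destruct (IHtrans g ltac:(tauto)) as (M & B & S).
    repeat split; [assumption|lia|discriminate].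
  - destruct (IHtrans (S g) Hg) as (M & B & _).
    destruct (act_env _ _ _); simpl; repeat split; [assumption|lia|discriminate].
  - destruct (IHtrans (S g) Hg) as (M & B & S1).
    destruct (act_env _ _ _); simpl; repeat split; [assumption|lia|].
    intros u ->; apply (S1 u); reflexivity.
Qed.

Lemma sends_bound_proc P : exists N, forall g, N <= g -> sends_proc g P = 0.
Proof.
  induction P; simpl;
    try (destruct IHP as [N HN]); try (destruct IHP1 as [N1 H1], IHP2 as [N2 H2]).
  - exists (S c + N); intros g Hg; rewrite HN by lia.
    destruct (Nat.eqb_spec c g); lia.
  - exists (N1 + N2); intros g Hg; rewrite H1, H2; lia.
  - eauto.
  - eauto.
  - exists (N1 + N2); intros g Hg; rewrite H1, H2; lia.
  - exists (N1 + N2); intros g Hg; rewrite H1, H2; lia.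
  - exists 0; auto.
  - exists 0; auto.
  - eauto.
Qed.

Lemma mild_bound W : exists N, forall g, N <= g -> mild g W.
Proof.
  induction W as [P|c P|W1 [N1 H1] W2 [N2 H2]|n u W [N HN]]; simpl.
  - destruct (sends_bound_proc P) as [N HN]; exists N; auto using sends_0_mild.
  - destruct (sends_bound_proc P) as [N HN]; exists N; auto using sends_0_mild.
  - exists (N1 + N2); intros g Hg; split; [apply H1|apply H2]; lia.
  - exists N; intros g Hg; apply HN; lia.
Qed.

(** * What a transition reads from its environment *)

Definition same_idle G H : Prop := forall c, idle G c <-> idle H c.
Definition same_last G H : Prop := forall c v, G c = (1, v) <-> H c = (1, v).

Lemma same_idle_cons p G H : same_idle G H -> same_idle (env_cons p G) (env_cons p H).
Proof. intros HGH [|c]; [split; auto|apply HGH]. Qed.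

Lemma same_last_cons p G H : same_last G H -> same_last (env_cons p G) (env_cons p H).
Proof. intros HGH [|c]; [split; auto|apply HGH]. Qed.

Lemma same_idle_exposed G H c : same_idle G H -> (exposed G c <-> exposed H c).
Proof. intros HGH; unfold exposed; specialize (HGH c); unfold idle in HGH; tauto. Qed.

(** Rules consult the environment to see whether a channel is idle. Only the time step of an active
    receiver asks more: whether the transmission ends now, and with which value. *)
Lemma trans_transfer G W l W' : trans G W l W' -> forall H, same_idle G H ->
  (l = ASigma -> same_last G H) -> trans H W l W'.
Proof.
  induction 1; intros G' Hi Hl;
    try (econstructor; eauto; fail).
  - apply TRcv, Hi; assumption.
  - apply TRcvIgn; intros [Hr1 Hr2]; apply H; split; [apply Hi|]; assumption.
  - apply TSyncL; [apply IHtrans1|apply IHtrans2]; auto; discriminate.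
  - apply TSyncR; [apply IHtrans1|apply IHtrans2]; auto; discriminate.
  - destruct (G' c) as [m u] eqn:HG'.
    apply TActRcv with (n := m) (w := u); [assumption|].
    destruct m as [|[|m]]; [| |lia].
    + specialize (Hi c); unfold idle in Hi; rewrite H, HG' in Hi; simpl in Hi; lia.
    + apply (Hl eq_refl) in HG'; rewrite H in HG'; injection HG'; lia.
  - apply TEndRcv, Hl; auto.
  - apply TTimeout, Hi; assumption.
  - apply TRcvLate; eapply same_idle_exposed in Hi; apply Hi; assumption.
  - apply TThen; destruct b; [assumption|].
    simpl in *; rewrite <- (same_idle_exposed _ _ c Hi); assumption.
  - apply TElse; destruct b; [assumption|].
    simpl in *; rewrite <- (same_idle_exposed _ _ c Hi); assumption.
  - apply TSumRcvL; [apply IHtrans; auto|]; destruct H0; split; [apply Hi|]; assumption.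
  - apply TSumRcvR; [apply IHtrans; auto|]; destruct H0; split; [apply Hi|]; assumption.
  - assert (HW : trans (env_cons (n, v) G') W (ASnd 0 w) W')
      by (apply IHtrans; [apply same_idle_cons; assumption|discriminate]).
    apply TResI in HW; exact HW.
  - assert (HW : trans (env_cons (n, v) G') W (shift_act l) W').
    { apply IHtrans; [apply same_idle_cons; assumption|].
      intros Hs; apply same_last_cons, Hl; destruct l; easy. }
    apply TResV in HW; destruct l; exact HW.
Qed.

(** An activated receiver does not store the value; it reads the channel state when the transmission
    ends. *)
Lemma trans_rcv_value G W c v W' v' : trans G W (ARcv c v) W' -> trans G W (ARcv c v') W'.
Proof.
  intros Ht; remember (ARcv c v) as l eqn:Hl; revert c Hl.
  induction Ht; intros c0 Hl; try discriminate Hl; try (injection Hl; intros; subst);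
    try (econstructor; eauto; fail).
  - destruct H as [->|(? & ? & ->)]; discriminate.
  - destruct H as [->|(? & ? & ->)]; discriminate.
  - assert (HW := IHHt (S c0) ltac:(subst; reflexivity)); subst l.
    apply (TResV _ _ _ _ _ (ARcv c0 v')) in HW; exact HW.
Qed.

(** * Parallel composition and strong bisimilarity of system terms *)

Definition par_step G W V l W' V' : Prop :=
  match l with
  | ARcv c v => trans G W (ARcv c v) W' /\ trans G V (ARcv c v) V'
  | ASigma => trans G W ASigma W' /\ trans G V ASigma V'
  | ATau => (trans G W ATau W' /\ V' = V) \/ (W' = W /\ trans G V ATau V')
  | ASnd c v => (trans G W (ASnd c v) W' /\ trans G V (ARcv c v) V') \/
                (trans G W (ARcv c v) W' /\ trans G V (ASnd c v) V')
  end.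

(** An input ignored by the whole composition is ignored by each component, so it too has the shape
    of (RcvPar). *)
Lemma par_inv G W V l X : trans G (SPar W V) l X ->
  exists W' V', X = SPar W' V' /\ par_step G W V l W' V'.
Proof.
  intros Ht; inversion Ht; subst; do 2 eexists; (split; [reflexivity|]); simpl; auto.
  split; apply TRcvIgn; intros [Hi Hr]; apply H; split; simpl; auto.
Qed.

Lemma par_intro G W V l W' V' : par_step G W V l W' V' -> trans G (SPar W V) l (SPar W' V').
Proof.
  destruct l; simpl; [intros [[? ?]|[? ?]]|intros [? ?]|intros [? ?]|
    intros [[? ->]|[-> ?]]]; constructor; assumption.
Qed.

(** The environment is quantified anew at every step, so terms are matched under arbitrary
    interference; this makes [sb] a congruence for parallel composition and restriction. *)
Definition strong (S : sys Sg -> sys Sg -> Prop) : Prop :=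
  forall X Y, S X Y -> forall G l X', trans G X l X' -> exists Y', trans G Y l Y' /\ S X' Y'.

Definition sb X Y : Prop :=
  exists S, (forall a b, S a b -> S b a) /\ strong S /\ S X Y.

Lemma sb_step X Y : sb X Y -> forall G l X', trans G X l X' ->
  exists Y', trans G Y l Y' /\ sb X' Y'.
Proof.
  intros (S & Hsym & Hs & HXY) G l X' Ht.
  destruct (Hs _ _ HXY _ _ _ Ht) as (Y' & HY & HS).
  exists Y'; split; [assumption|]; exists S; auto.
Qed.

Lemma sb_sym X Y : sb X Y -> sb Y X.
Proof. intros (S & Hsym & Hs & HXY); exists S; auto. Qed.

Lemma sb_refl X : sb X X.
Proof.
  exists eq; split; [auto|]; split; [|reflexivity].
  intros a b <- G l a' Ht; eauto.
Qed.

Lemma sb_intro (S : sys Sg -> sys Sg -> Prop) X Y :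
  strong S -> strong (fun a b => S b a) -> S X Y -> sb X Y.
Proof.
  intros H1 H2 HXY; exists (fun a b => S a b \/ S b a); split; [tauto|]; split; [|auto].
  intros a b [Hab|Hab] G l a' Ht.
  - destruct (H1 _ _ Hab _ _ _ Ht) as (b' & ? & ?); eauto.
  - destruct (H2 _ _ Hab _ _ _ Ht) as (b' & ? & ?); eauto.
Qed.

Lemma sb_trans X Y Z : sb X Y -> sb Y Z -> sb X Z.
Proof.
  intros HXY HYZ; exists (fun a c => exists b, sb a b /\ sb b c); split; [|split].
  - intros a c (b & ? & ?); exists b; auto using sb_sym.
  - intros a c (b & Hab & Hbc) G l a' Ht.
    destruct (sb_step _ _ Hab _ _ _ Ht) as (b' & Hb & ?).
    destruct (sb_step _ _ Hbc _ _ _ Hb) as (c' & ? & ?); eauto.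
  - eauto.
Qed.

Lemma sb_par X X' Y Y' : sb X X' -> sb Y Y' -> sb (SPar X Y) (SPar X' Y').
Proof.
  intros HX HY.
  exists (fun a b => exists a1 a2 b1 b2,
            a = SPar a1 a2 /\ b = SPar b1 b2 /\ sb a1 b1 /\ sb a2 b2).
  split; [|split].
  - intros a b (a1 & a2 & b1 & b2 & ? & ? & ? & ?); exists b1, b2, a1, a2; auto using sb_sym.
  - intros a b (a1 & a2 & b1 & b2 & -> & -> & H1 & H2) G l a' Ht.
    apply par_inv in Ht as (a1' & a2' & -> & Ht).
    enough (exists b1' b2', par_step G b1 b2 l b1' b2' /\ sb a1' b1' /\ sb a2' b2')
      as (b1' & b2' & Hb & ? & ?).
    { exists (SPar b1' b2'); split; [apply par_intro, Hb|].
      exists a1', a2', b1', b2'; auto. }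
    destruct l; simpl in *;
      repeat match goal with
      | h : _ /\ _ |- _ => destruct h
      | h : _ \/ _ |- _ => destruct h
      end; subst;
      repeat match goal with
      | h1 : sb ?x ?y, h2 : trans _ ?x _ _ |- _ =>
          destruct (sb_step _ _ h1 _ _ _ h2) as (? & ? & ?); clear h2
      end; do 2 eexists; eauto 7.
  - exists X, Y, X', Y'; auto.
Qed.

Lemma sb_res n v X X' : sb X X' -> sb (SRes n v X) (SRes n v X').
Proof.
  intros HX.
  exists (fun a b => exists n v a1 b1, a = SRes n v a1 /\ b = SRes n v b1 /\ sb a1 b1).
  split; [|split].
  - intros a b (n0 & v0 & a1 & b1 & ? & ? & ?); exists n0, v0, b1, a1; auto using sb_sym.
  - intros a b (n0 & v0 & a1 & b1 & -> & -> & H1) G l a' Ht.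
    inversion Ht; subst.
    + destruct (sb_step _ _ H1 (env_cons (n0, v0) G) (shift_act (ARcv c v1)) a1)
        as (b1' & Hb & Hs).
      { apply TRcvIgn; intros [Hi Hr]; apply H; split; assumption. }
      exists (SRes n0 v0 b1'); split; [|exists n0, v0, a1, b1'; auto].
      apply TResV in Hb; exact Hb.
    + match goal with h : trans (env_cons _ _) _ _ _ |- _ =>
        destruct (sb_step _ _ H1 _ _ _ h) as (b1' & Hb & Hs) end.
      eexists; split; [apply TResI; eassumption|].
      destruct (act_env _ _ _) as [n' v']; exists n', v', W', b1'; auto.
    + match goal with h : trans (env_cons _ _) _ _ _ |- _ =>
        destruct (sb_step _ _ H1 _ _ _ h) as (b1' & Hb & Hs) end.
      eexists; split; [apply TResV; eassumption|].
      destruct (act_env _ _ _) as [n' v']; exists n', v', W', b1'; auto.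
  - exists n, v, X, X'; auto.
Qed.

Lemma sb_fix P : guarded 0 P -> sb (SProc (PFix P)) (SProc (unfold P)).
Proof.
  intros Hg.
  apply sb_intro with (S := fun a b => a = b \/
    (a = SProc (PFix P) /\ b = SProc (unfold P))); [| |auto].
  - intros a b [->|[-> ->]] G l a' Ht; [eauto|].
    inversion Ht; subst.
    + exists (SProc (unfold P)); split; [|auto].
      apply TRcvIgn; intros [Hi Hr]; apply H; split; [assumption|].
      apply (rcv_unfold P c Hg), Hr.
    + eauto.
  - intros b a [->|[-> ->]] G l a' Ht; [eauto|].
    exists a'; split; [apply TRec|]; auto.
Qed.

(* Not an equality: (Rec) over (RcvIgn) unfolds a recursion while ignoring the input. *)
Lemma sb_exposed_input G V c v V' : trans G V (ARcv c v) V' -> closed_sys V ->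
  exposed G c -> sb V V'.
Proof.
  intros Ht; remember (ARcv c v) as l eqn:Hl; revert c Hl.
  induction Ht; intros c0 Hl Hc He; try discriminate Hl;
    try (injection Hl; intros; subst); try (exfalso; apply He; assumption).
  - apply sb_refl.
  - destruct Hc; apply sb_par; eauto.
  - eapply sb_trans; [apply sb_fix, Hc|]; eapply IHHt; eauto using closed_unfold.
  - destruct H as [->|(? & ? & ->)]; discriminate.
  - destruct H as [->|(? & ? & ->)]; discriminate.
  - exfalso; apply He, H.
  - exfalso; apply He, H.
  - subst l; simpl; apply sb_res, (IHHt (S c0)); auto.
Qed.

Lemma rcv_ignored G W c v : (forall d, ~ rcv_sys W d) -> trans G W (ARcv c v) W.
Proof. intros HW; apply TRcvIgn; intros [_ Hr]; apply (HW _ Hr). Qed.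

Definition nil_sys : sys Sg := SProc PNil.

Lemma nil_inv G l X : trans G nil_sys l X ->
  X = nil_sys /\ (l = ASigma \/ exists c v, l = ARcv c v).
Proof. intros Ht; inversion Ht; subst; eauto. Qed.

Lemma nil_rcv G c v : trans G nil_sys (ARcv c v) nil_sys.
Proof. apply rcv_ignored; intros d []. Qed.

Lemma sb_nil W : sb (SPar W nil_sys) W.
Proof.
  apply sb_intro with (S := fun a b => a = SPar b nil_sys); [| |reflexivity].
  - intros a b -> G l a' Ht.
    apply par_inv in Ht as (b' & n' & -> & Ht).
    enough (trans G b l b' /\ n' = nil_sys) as [? ->] by eauto.
    destruct l; simpl in Ht;
      repeat match goal with
      | h : _ /\ _ |- _ => destruct h
      | h : _ \/ _ |- _ => destruct h
      | h : trans _ nil_sys _ _ |- _ => apply nil_inv in h as [? [?|(? & ? & ?)]]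
      end; subst; try discriminate; auto.
  - intros b a -> G l b' Ht.
    exists (SPar b' nil_sys); split; [|reflexivity]; apply par_intro.
    destruct l; simpl; auto using nil_rcv; split; auto; constructor.
Qed.

(** Contexts are appended on the right; this reordering is all that is needed to move a component
    past a tester. *)
Lemma sb_swap X Y Z : sb (SPar (SPar X Y) Z) (SPar (SPar X Z) Y).
Proof.
  exists (fun a b => exists x y z, a = SPar (SPar x y) z /\ b = SPar (SPar x z) y).
  split; [intros a b (x & y & z & -> & ->); exists x, z, y; auto|].
  split; [|eauto 6].
  intros a b (x & y & z & -> & ->) G l a' Ht.
  apply par_inv in Ht as (xy' & z' & -> & Ht).
  enough (exists x' y', xy' = SPar x' y' /\ trans G (SPar (SPar x z) y) l (SPar (SPar x' z') y'))
    as (x' & y' & -> & ?) by eauto 8.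
  destruct l; simpl in Ht;
    repeat match goal with
    | h : _ /\ _ |- _ => destruct h
    | h : _ \/ _ |- _ => destruct h
    | h : trans _ (SPar _ _) _ _ |- _ => apply par_inv in h as (? & ? & -> & h); simpl in h
    end; subst; do 2 eexists; (split; [reflexivity|]);
    repeat (apply par_intro; simpl);
    eauto 6 using TRcvPar, TSyncL, TSyncR, TTimePar, TTauParL, TTauParR.
Qed.

(** * Instantaneous and timed reductions *)

Definition step C D : Prop := ext C ETau D.
Definition tick C D : Prop :=
  exists W', trans (fst C) (snd C) ASigma W' /\ D = (act_env ASigma (fst C), W').

Lemma step_iff G W D : step (G, W) D <->
  exists l W', inst l /\ trans G W l W' /\ D = (act_env l G, W').
Proof.
  split.
  - intros Hs; inversion Hs; subst.
    + exists (ASnd c v), W'; split; [right; eauto|auto].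
    + exists ATau, W'; split; [left; reflexivity|auto].
  - intros (l & W' & [->|(c & v & ->)] & Ht & ->); constructor; assumption.
Qed.

Lemma red_iff C D : red C D <-> step C D \/ tick C D.
Proof.
  destruct C as [G W]; rewrite step_iff; split.
  - intros (l & W' & Hl & Ht & ->); simpl in *.
    destruct l as [c v|c v| |].
    + left; exists (ASnd c v), W'; split; [right; eauto|auto].
    + exfalso; apply (Hl c v); reflexivity.
    + right; exists W'; auto.
    + left; exists ATau, W'; split; [left; reflexivity|auto].
  - intros [(l & W' & Hl & Ht & ->)|(W' & Ht & ->)].
    + exists l, W'; split; [|auto]; intros c v ->; destruct Hl as [?|(? & ? & ?)]; discriminate.
    + exists ASigma, W'; split; [discriminate|auto].
Qed.

Lemma star_invariant {A : Type} {R : A -> A -> Prop} (I : A -> Prop) :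
  (forall x y, I x -> R x y -> I y) ->
  forall x y, clos_refl_trans A R x y -> I x -> I y.
Proof. intros HI x y Hxy; induction Hxy; eauto. Qed.

Lemma tau_star_red C D : tau_star C D -> red_star C D.
Proof.
  intros Hs; induction Hs; [apply rt_step, red_iff; left; assumption|apply rt_refl|].
  eapply rt_trans; eassumption.
Qed.

Lemma tick_red C D : tick C D -> red_star C D.
Proof. intros Ht; apply rt_step, red_iff; right; assumption. Qed.

Lemma step_exposed G W G' W' c : step (G, W) (G', W') -> exposed G c -> exposed G' c.
Proof.
  rewrite step_iff; intros (l & X & Hl & Ht & [= -> ->]) He.
  destruct Hl as [->|(d & v & ->)]; [assumption|apply bcast_exposed_mono, He].
Qed.

Lemma tau_star_exposed C D c : tau_star C D -> exposed (fst C) c -> exposed (fst D) c.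
Proof.
  apply star_invariant with (I := fun D => exposed (fst D) c).
  intros [G W] [G' W'] He Hs; eapply step_exposed; eassumption.
Qed.

Lemma red_closed C D : red C D -> is_config C -> is_config D.
Proof.
  intros (l & W' & _ & Ht & ->) Hc; unfold is_config in *; simpl.
  eapply trans_closed; eassumption.
Qed.

Lemma red_wf C D : red C D -> well_formed C -> well_formed D.
Proof.
  intros Hr [Hc Hw]; split; [eapply red_closed; eassumption|].
  destruct Hr as (l & W' & _ & Ht & ->); eapply trans_wf; eassumption.
Qed.

Lemma red_star_closed C D : red_star C D -> is_config C -> is_config D.
Proof. apply star_invariant; intros; eapply red_closed; eassumption. Qed.

Lemma red_star_wf C D : red_star C D -> well_formed C -> well_formed D.
Proof. apply star_invariant; intros; eapply red_wf; eassumption. Qed.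

Lemma tau_star_wf C D : tau_star C D -> well_formed C -> well_formed D.
Proof. intros Hs Hw; exact (red_star_wf _ _ (tau_star_red _ _ Hs) Hw). Qed.

Lemma tau_star_stuck C D : (forall D, ~ step C D) -> tau_star C D -> D = C.
Proof.
  intros HC Hs; apply clos_rt_rt1n in Hs; destruct Hs as [|D E Hs]; [reflexivity|].
  destruct (HC _ Hs).
Qed.

Lemma tick_no_step C D : tick C D -> forall D', ~ step C D'.
Proof.
  destruct C as [G W]; intros (W' & Ht & _) D'; rewrite step_iff.
  intros (l & X & Hl & Hx & _); eapply maximal_progress; eassumption.
Qed.

(** * A refined bisimilarity contained in reduction barbed congruence *)

(* Compared with [bisimulation]: exposures agree, an input on an idle channel is
   answered while that channel is still idle, and a time step is answered from a
   state delivering the same values.  Plain bisimilarity is not preserved by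
   parallel contexts: with [err] as the only value, of transmission time 1, an
   input on [c] could be answered by first broadcasting on [c], which a context
   [c!<e>.P + |_?c(x).Q_|R] observes. *)
Record refined (S : config Sg -> config Sg -> Prop) : Prop := {
  refined_sym : forall C D, S C D -> S D C;
  refined_idle : forall C D, S C D -> same_idle (fst C) (fst D);
  refined_tau : forall C D C', S C D -> step C C' -> exists D', tau_star D D' /\ S C' D';
  refined_input : forall G W D c v W', S (G, W) D -> trans G W (ARcv c v) W' ->
    exists H X X' D', tau_star D (H, X) /\ (idle G c -> idle H c) /\
      trans H X (ARcv c v) X' /\ tau_star (bcast_env c v H, X') D' /\
      S (bcast_env c v G, W') D';
  refined_time : forall C D C', S C D -> tick C C' ->
    exists E E' D', tau_star D E /\ same_last (fst C) (fst E) /\ tick E E' /\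
      tau_star E' D' /\ S C' D' }.

Definition rbisim C D : Prop := exists S, refined S /\ S C D.

Lemma rbisim_refined : refined rbisim.
Proof.
  constructor.
  - intros C D (S & HS & HCD); exists S; split; [|apply (refined_sym _ HS)]; assumption.
  - intros C D (S & HS & HCD); apply (refined_idle _ HS _ _ HCD).
  - intros C D C' (S & HS & HCD) Hs.
    destruct (refined_tau _ HS _ _ _ HCD Hs) as (D' & ? & ?).
    exists D'; split; [|exists S]; auto.
  - intros G W D c v W' (S & HS & HCD) Ht.
    destruct (refined_input _ HS _ _ _ _ _ _ HCD Ht) as (H & X & X' & D' & ? & ? & ? & ? & ?).
    exists H, X, X', D'; repeat split; auto; exists S; auto.
  - intros C D C' (S & HS & HCD) Ht.
    destruct (refined_time _ HS _ _ _ HCD Ht) as (E & E' & D' & ? & ? & ? & ? & ?).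
    exists E, E', D'; do 4 (split; [assumption|]); exists S; auto.
Qed.

Definition par C V : config Sg := (fst C, SPar (snd C) V).

Lemma idle_back C D c : tau_star C D -> idle (fst D) c -> idle (fst C) c.
Proof.
  intros Hs HD; apply NNPP; intros HC.
  exact (tau_star_exposed _ _ c Hs HC HD).
Qed.

(** If the run leaves every idle channel idle, each of its broadcasts falls on a channel that was
    exposed already, so [V] ignores them all. *)
Lemma tau_lift_same C D V : tau_star C D -> (forall c, idle (fst C) c -> idle (fst D) c) ->
  tau_star (par C V) (par D V).
Proof.
  intros Hs; apply clos_rt_rt1n in Hs.
  induction Hs as [C|[G W] E D Hs Hs' IH]; intros Hi; [apply rt_refl|].
  apply clos_rt1n_rt in Hs'.
  apply rt_trans with (par E V).
  - apply rt_step, step_iff; apply step_iff in Hs as (l & W' & Hl & Ht & ->).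
    exists l, (SPar W' V); repeat split; [assumption|].
    destruct Hl as [->|(d & u & ->)]; [apply TTauParL; assumption|].
    apply TSyncL; [assumption|]; apply TRcvIgn; intros [Hd _].
    apply (tau_star_exposed _ _ d Hs'); [apply bcast_exposed|apply Hi, Hd].
  - apply IH; intros c Hc; apply Hi, (idle_back (G, W) E); [apply rt_step|]; assumption.
Qed.

(** The first broadcast on [d] in the run activates the receivers in [V]; all others fall on exposed
    channels and are ignored. The value broadcast may differ from [u], which [trans_rcv_value] makes
    harmless. *)
Lemma tau_lift_input C D V V' d u : tau_star C D -> idle (fst C) d -> exposed (fst D) d ->
  (forall c, c <> d -> idle (fst C) c -> idle (fst D) c) ->
  trans (fst C) V (ARcv d u) V' -> tau_star (par C V) (par D V').
Proof.
  intros Hs; apply clos_rt_rt1n in Hs.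
  induction Hs as [C|[G W] E D Hs Hs' IH]; intros HC HD Hi HV; [contradiction|].
  apply clos_rt1n_rt in Hs'; assert (Hb := fun c => idle_back (G, W) E c (rt_step _ _ _ _ Hs)).
  apply step_iff in Hs as (l & W' & Hl & Ht & ->).
  destruct Hl as [->|(d' & u' & ->)].
  - apply rt_trans with (par (G, W') V); [|apply IH; auto].
    apply rt_step, step_iff; exists ATau, (SPar W' V); repeat split; [left; reflexivity|].
    apply TTauParL; assumption.
  - assert (Hd' : exposed (fst D) d').
    { apply (tau_star_exposed _ _ d' Hs'), bcast_exposed. }
    destruct (Nat.eq_dec d' d) as [->|Hdd].
    + apply rt_trans with (par (bcast_env d u' G, W') V').
      * apply rt_step, step_iff; exists (ASnd d u'), (SPar W' V').
        repeat split; [right; eauto|].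
        apply TSyncL; [assumption|]; eapply trans_rcv_value; eassumption.
      * apply tau_lift_same; [assumption|]; intros c Hc.
        apply Hi; [|apply Hb, Hc]; intros ->; revert Hc; apply bcast_exposed.
    + assert (He : exposed G d') by (intros Hd; apply Hd', Hi; assumption).
      assert (Hsame : same_idle G (bcast_env d' u' G)).
      { intros c; split; [|apply Hb].
        destruct (Nat.eq_dec c d') as [->|Hc]; [contradiction|].
        unfold idle; rewrite bcast_other by assumption; auto. }
      apply rt_trans with (par (bcast_env d' u' G, W') V).
      * apply rt_step, step_iff; exists (ASnd d' u'), (SPar W' V).
        repeat split; [right; eauto|].
        apply TSyncL; [assumption|]; apply TRcvIgn; intros [? _]; contradiction.
      * apply IH; auto; [apply Hsame; assumption|].
        eapply trans_transfer; [eassumption|assumption|discriminate].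
Qed.

Lemma rbisim_exposed_step C C' D D' : rbisim C D -> rbisim C' D' ->
  (forall c, idle (fst C) c -> idle (fst C') c) -> forall c, idle (fst D) c -> idle (fst D') c.
Proof.
  intros H1 H2 Hi c Hc.
  apply (refined_idle _ rbisim_refined _ _ H2), Hi, (refined_idle _ rbisim_refined _ _ H1), Hc.
Qed.

Lemma tau_lift_tick C C' V V' : tick C C' -> trans (fst C) V ASigma V' -> tick (par C V) (par C' V').
Proof.
  intros (W' & Ht & ->) HV; exists (SPar W' V'); split; [apply TTimePar; assumption|reflexivity].
Qed.

Lemma idle_bcast c v G d : idle (bcast_env c v G) d <-> d <> c /\ idle G d.
Proof.
  destruct (Nat.eq_dec d c) as [->|Hd].
  - split; [intros Hi; destruct (bcast_exposed _ _ _ Hi)|tauto].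
  - unfold idle; rewrite bcast_other by assumption; tauto.
Qed.

(* The answer to an input keeps every channel other than [c] as it was, so that a
   parallel component can stay put until the input itself. *)
Lemma rbisim_input_idle G W D c v W' H X X' D' :
  rbisim (G, W) D -> rbisim (bcast_env c v G, W') D' ->
  tau_star D (H, X) -> (idle G c -> idle H c) -> tau_star (bcast_env c v H, X') D' ->
  same_idle G H /\ same_idle (fst D) H /\
  (forall d, idle (bcast_env c v H) d -> idle (fst D') d).
Proof.
  intros HD HD' Hs1 Hc Hs2.
  assert (E1 := refined_idle _ rbisim_refined _ _ HD).
  assert (E2 := refined_idle _ rbisim_refined _ _ HD').
  simpl in E1, E2.
  assert (HGH : forall d, idle G d -> idle H d).
  { intros d Hd; destruct (Nat.eq_dec d c) as [->|Hdc]; [auto|].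
    assert (Hd' : idle (fst D') d) by (apply E2, idle_bcast; auto).
    apply (idle_back _ _ d Hs2), idle_bcast in Hd'; tauto. }
  assert (HHG : forall d, idle H d -> idle G d).
  { intros d Hd; apply E1, (idle_back _ _ d Hs1), Hd. }
  assert (HS : same_idle G H) by (intros d; split; auto).
  repeat split; auto.
  - intros Hd; apply HGH, E1, Hd.
  - intros Hd; apply E1, HHG, Hd.
  - intros d Hd; apply E2; apply idle_bcast in Hd; apply idle_bcast.
    split; [|apply HHG]; tauto.
Qed.

(** A channel idle after a tick was idle or in its last unit before it. Agreement on idle channels
    at both ends, together with [same_last] at the tick, ties the channels idle in [E] to those idle
    in [C], so neither stretch of the answer exposes a channel. *)
Lemma rbisim_time_idle C D C' D' E E' : rbisim C D -> rbisim C' D' ->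
  tick C C' -> tau_star D E -> same_last (fst C) (fst E) -> tick E E' -> tau_star E' D' ->
  same_idle (fst C) (fst E) /\ same_idle (fst D) (fst E) /\
  (forall c, idle (fst E') c -> idle (fst D') c).
Proof.
  intros HD HD' Ht1 Hs1 Hl Ht2 Hs2.
  assert (E1 := refined_idle _ rbisim_refined _ _ HD).
  assert (E2 := refined_idle _ rbisim_refined _ _ HD').
  destruct Ht1 as (W' & _ & ->), Ht2 as (X' & _ & ->); simpl fst in *.
  assert (Hsig : forall G c, idle (act_env ASigma G) c <-> idle G c \/ exists v, G c = (1, v)).
  { intros G c; unfold idle; rewrite sigma_fst; destruct (G c) as [n v]; simpl; split.
    - intros Hn; destruct n as [|[|n]]; [auto|right; eauto|lia].
    - intros [->|[u [= -> _]]]; reflexivity. }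
  assert (HCE : forall c, idle (fst C) c -> idle (fst E) c).
  { intros c Hc.
    assert (Hc' : idle (fst D') c) by (apply E2, Hsig; auto).
    apply (idle_back _ _ c Hs2), Hsig in Hc'; destruct Hc' as [?|[v Hv]]; [assumption|].
    apply Hl in Hv; unfold idle in Hc; rewrite Hv in Hc; discriminate. }
  assert (HEC : forall c, idle (fst E) c -> idle (fst C) c).
  { intros c Hc; apply E1, (idle_back _ _ c Hs1), Hc. }
  repeat split; auto.
  - intros Hc; apply HCE, E1, Hc.
  - intros Hc; apply E1, HEC, Hc.
  - intros c Hc; apply E2, Hsig; apply Hsig in Hc.
    destruct Hc as [?|[v Hv]]; [auto|right; exists v; apply Hl, Hv].
Qed.

(** [V1] and [V2] may differ: an input ignored on an exposed channel can unfold a recursion in [V1]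
    while [V2] stays put. *)
Definition par_rbisim C D : Prop :=
  exists C0 D0 V1 V2, C = par C0 V1 /\ D = par D0 V2 /\ rbisim C0 D0 /\ sb V1 V2 /\
    closed_sys V1 /\ closed_sys V2.

Lemma par_rbisim_refined : refined par_rbisim.
Proof.
  assert (HR := rbisim_refined).
  constructor.
  - intros C D (C0 & D0 & V1 & V2 & -> & -> & HCD & HV & Hc1 & Hc2).
    exists D0, C0, V2, V1; repeat split; auto using sb_sym.
    apply (refined_sym _ HR), HCD.
  - intros C D (C0 & D0 & V1 & V2 & -> & -> & HCD & _); apply (refined_idle _ HR _ _ HCD).
  - intros C D C' ([G W] & D0 & V1 & V2 & -> & -> & HCD & HV & Hc1 & Hc2) Hs.
    assert (E1 := refined_idle _ HR _ _ HCD); simpl in E1.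
    apply step_iff in Hs as (l & X & Hl & Ht & ->).
    apply par_inv in Ht as (W' & V1' & -> & Ht).
    destruct Hl as [->|(d & u & ->)]; simpl in Ht; destruct Ht as [[Ht1 Ht2]|[Ht1 Ht2]].
    + subst V1'; destruct (refined_tau _ HR _ _ (G, W') HCD) as (D' & Hs & HD').
      { apply step_iff; exists ATau, W'; repeat split; [left; reflexivity|assumption]. }
      exists (par D' V2); split.
      * apply tau_lift_same; [assumption|].
        apply (rbisim_exposed_step _ _ _ _ HCD HD'); auto.
      * exists (G, W'), D', V1, V2; repeat split; auto.
    + subst W'; destruct (sb_step _ _ HV _ _ _ Ht2) as (V2' & Ht & HV').
      exists (par D0 V2'); split.
      * apply rt_step; destruct D0 as [H X]; apply step_iff.
        exists ATau, (SPar X V2'); repeat split; [left; reflexivity|].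
        apply TTauParR; eapply trans_transfer; [eassumption|assumption|discriminate].
      * exists (G, W), D0, V1', V2'; repeat split; eauto using trans_closed.
    + destruct (refined_tau _ HR _ _ (bcast_env d u G, W') HCD) as (D' & Hs & HD').
      { apply step_iff; exists (ASnd d u), W'; repeat split; [right; eauto|assumption]. }
      assert (E2 := refined_idle _ HR _ _ HD'); simpl in E2.
      (* If [d] was idle, the answer must expose [d] and no other channel, so [V2] takes its input
         at the first broadcast on [d]. If [d] was exposed, the answer exposes nothing new and [V2]
         stays as it is. *)
      destruct (classic (idle G d)) as [Hd|Hd].
      * destruct (sb_step _ _ HV _ _ _ Ht2) as (V2' & Ht & HV').
        exists (par D' V2'); split.
        -- eapply tau_lift_input with (d := d) (u := u); [assumption|apply E1, Hd| | |].
           ++ intros Hd'; apply E2 in Hd'; revert Hd'; apply bcast_exposed.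
           ++ intros c Hcd Hc; apply E2, idle_bcast; split; [|apply E1]; assumption.
           ++ eapply trans_transfer; [eassumption|assumption|discriminate].
        -- exists (bcast_env d u G, W'), D', V1', V2'; repeat split; eauto using trans_closed.
      * exists (par D' V2); split.
        -- apply tau_lift_same; [assumption|].
           apply (rbisim_exposed_step _ _ _ _ HCD HD'); simpl.
           intros c Hc; apply idle_bcast; split; [intros ->; contradiction|assumption].
        -- exists (bcast_env d u G, W'), D', V1', V2; repeat split; eauto using trans_closed.
           eapply sb_trans; [apply sb_sym; eapply sb_exposed_input; eassumption|assumption].
    (* Here [V1] broadcasts. The stretches of the answer before and after its input expose no
       channel, so [V2] is undisturbed around its own broadcast. *)
    + destruct (refined_input _ HR _ _ _ _ _ _ HCD Ht1)
        as (H & X & X' & D' & Hs1 & Hi & Hin & Hs2 & HD').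
      destruct (rbisim_input_idle _ _ _ _ _ _ _ _ _ _ HCD HD' Hs1 Hi Hs2) as (I1 & I2 & I3).
      destruct (sb_step _ _ HV _ _ _ Ht2) as (V2' & Ht & HV').
      exists (par D' V2'); split.
      * eapply rt_trans; [apply (tau_lift_same _ _ V2 Hs1); intros c; apply I2|].
        eapply rt_trans; [|apply (tau_lift_same _ _ V2' Hs2), I3].
        apply rt_step, step_iff; exists (ASnd d u), (SPar X' V2').
        repeat split; [right; eauto|].
        apply TSyncR; [assumption|]; eapply trans_transfer; [eassumption|assumption|discriminate].
      * exists (bcast_env d u G, W'), D', V1', V2'; repeat split; eauto using trans_closed.
  - intros G Y D c v Y' ([G0 W] & D0 & V1 & V2 & [= -> ->] & -> & HCD & HV & Hc1 & Hc2) Ht.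
    apply par_inv in Ht as (W' & V1' & -> & Ht1 & Ht2); simpl in Ht1, Ht2.
    destruct (refined_input _ HR _ _ _ _ _ _ HCD Ht1)
      as (H & X & X' & D' & Hs1 & Hi & Hin & Hs2 & HD').
    destruct (rbisim_input_idle _ _ _ _ _ _ _ _ _ _ HCD HD' Hs1 Hi Hs2) as (I1 & I2 & I3).
    destruct (sb_step _ _ HV _ _ _ Ht2) as (V2' & Ht & HV').
    exists H, (SPar X V2), (SPar X' V2'), (par D' V2'); repeat split; auto.
    + apply (tau_lift_same _ _ V2 Hs1); intros d; apply I2.
    + apply TRcvPar; [assumption|]; eapply trans_transfer; [eassumption|assumption|discriminate].
    + apply (tau_lift_same _ _ V2' Hs2), I3.
    + exists (bcast_env c v G0, W'), D', V1', V2'; repeat split; eauto using trans_closed.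
  - intros C D C' ([G W] & D0 & V1 & V2 & -> & -> & HCD & HV & Hc1 & Hc2) (Y & Ht & ->).
    apply par_inv in Ht as (W' & V1' & -> & Ht1 & Ht2); simpl in Ht1, Ht2.
    assert (Htick : tick (G, W) (act_env ASigma G, W')) by (exists W'; auto).
    destruct (refined_time _ HR _ _ _ HCD Htick) as (E & E' & D' & Hs1 & Hl & HtE & Hs2 & HD').
    destruct (rbisim_time_idle _ _ _ _ _ _ HCD HD' Htick Hs1 Hl HtE Hs2) as (I1 & I2 & I3).
    destruct (sb_step _ _ HV _ _ _ Ht2) as (V2' & Ht & HV').
    exists (par E V2), (par E' V2'), (par D' V2').
    split; [|split; [exact Hl|split; [|split]]].
    + apply tau_lift_same; [assumption|]; intros d; apply I2.
    + apply tau_lift_tick; [assumption|].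
      eapply trans_transfer; [eassumption|assumption|auto].
    + apply tau_lift_same; assumption.
    + exists (act_env ASigma G, W'), D', V1', V2'; repeat split; eauto using trans_closed.
Qed.

Lemma rbisim_par C D V : rbisim C D -> closed_sys V -> rbisim (par C V) (par D V).
Proof.
  intros HCD HV; exists par_rbisim; split; [apply par_rbisim_refined|].
  exists C, D, V, V; repeat split; auto using sb_refl.
Qed.

Lemma rbisim_red C D C' : rbisim C D -> red C C' -> exists D', red_star D D' /\ rbisim C' D'.
Proof.
  intros HCD Hr; apply red_iff in Hr as [Hs|Ht].
  - destruct (refined_tau _ rbisim_refined _ _ _ HCD Hs) as (D' & ? & ?).
    eauto using tau_star_red.
  - destruct (refined_time _ rbisim_refined _ _ _ HCD Ht) as (E & E' & D' & ? & _ & ? & ? & ?).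
    exists D'; split; [|assumption].
    eapply rt_trans; [apply tau_star_red; eassumption|].
    eapply rt_trans; [apply tick_red; eassumption|apply tau_star_red; assumption].
Qed.

Lemma rbisim_red_star C D C' : rbisim C D -> red_star C C' ->
  exists D', red_star D D' /\ rbisim C' D'.
Proof.
  intros HCD Hr; revert D HCD; apply clos_rt_rt1n in Hr.
  induction Hr as [C|C E C' Hr _ IH]; intros D HCD; [exists D; split; [apply rt_refl|assumption]|].
  destruct (rbisim_red _ _ _ HCD Hr) as (D1 & H1 & HE).
  destruct (IH _ HE) as (D2 & H2 & ?); exists D2; split; [eapply rt_trans; eassumption|assumption].
Qed.

Lemma rbisim_rbc C D : is_config C -> is_config D -> rbisim C D -> rbc C D.
Proof.
  intros HC HD HCD.
  exists (fun C D => is_config C /\ is_config D /\ rbisim C D).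
  split; [|split; [|split; [|split; [|split]]]]; auto.
  - tauto.
  - intros D1 D2 (? & ? & ?); repeat split; auto.
    apply (refined_sym _ rbisim_refined); assumption.
  - intros C1 C2 c (_ & _ & HCC) (C1' & Hr & Hb).
    destruct (rbisim_red_star _ _ _ HCC Hr) as (C2' & Hr' & HCC').
    exists C2'; split; [assumption|]; intros Hi; apply Hb.
    apply (refined_idle _ rbisim_refined _ _ HCC'), Hi.
  - intros C1 C2 C1' (H1 & H2 & HCC) Hr.
    destruct (rbisim_red _ _ _ HCC Hr) as (C2' & Hr' & HCC').
    exists C2'; repeat split; auto; [eapply red_closed|eapply red_star_closed]; eassumption.
  - intros G1 W1 G2 W2 W (H1 & H2 & HCC) HW; repeat split; auto.
    apply (rbisim_par _ _ W HCC HW).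
Qed.

(** * Testers *)

Definition caller (g : chan) : proc Sg := PFix (PSnd g (EVal (VCl (err Sg))) (PVar 0)).

(* Has no time step, so time is blocked until it commits to one of the summands. *)
Definition choice (g : chan) : proc Sg := PSum (PTau (caller g)) (PTau PNil).

Definition pending (k : nat) (g : chan) : sys Sg := SProc (sigma_n k (choice g)).

(** The index counts the delays left before the next call, so that time steps can be shown to bring
    it closer. The clause [calls_snd] is there because an ignored input may unfold the recursion. *)
Inductive calls (g : chan) : nat -> sys Sg -> Prop :=
| calls_fix : calls g 0 (SProc (caller g))
| calls_snd : calls g 0 (SProc (PSnd g (EVal (VCl (err Sg))) (caller g)))
| calls_sigma k P : calls g k (SProc P) -> calls g (S k) (SProc (PSigma P))
| calls_l k X Y : calls g k X -> calls g k (SPar X Y)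
| calls_r k X Y : calls g k Y -> calls g k (SPar X Y).

Definition calling (g : chan) C : Prop := exists k, calls g k (snd C).

Lemma calls_sigma_n g n : calls g n (SProc (sigma_n n (caller g))).
Proof. induction n; simpl; constructor; assumption. Qed.

(** After a broadcast the caller restarts behind as many delays as [err] takes to transmit, so the
    count may grow from 0; a positive count is changed by time alone. *)
Lemma calls_trans g k X : calls g k X -> forall G l Y, trans G X l Y ->
  exists k', calls g k' Y /\ (l = ASigma -> S k' = k) /\ (l <> ASigma -> 0 < k -> k' = k).
Proof.
  induction 1 as [| |k P Hk IH|k X Y Hk IH|k X Y Hk IH]; intros G l Z Ht.
  - inversion Ht as [| |? ? c v Hr| | | | | | | | | | | | | | | |? ? ? ? Hu| | | | | | |]; subst.
    + exists 0; repeat split; [constructor|discriminate].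
    + unfold Defs.unfold in Hu; simpl in Hu; inversion Hu; subst.
      * eexists; split; [apply calls_sigma_n|]; split; [discriminate|lia].
      * exists 0; split; [apply calls_snd|]; split; [discriminate|lia].
  - inversion Ht; subst.
    + eexists; split; [apply calls_sigma_n|]; split; [discriminate|lia].
    + exists 0; split; [apply calls_snd|]; split; [discriminate|lia].
  - inversion Ht; subst.
    + exists (S k); split; [constructor; assumption|]; split; [discriminate|auto].
    + exists k; split; [assumption|]; split; [auto|congruence].
  - apply par_inv in Ht as (X' & Y' & -> & Ht).
    assert (HX : trans G X l X' \/ (X' = X /\ l = ATau) \/
                 exists c v, l = ASnd c v /\ trans G X (ARcv c v) X').
    { destruct l; simpl in Ht; intuition eauto. }
    destruct HX as [HX|[[-> ->]|(c & v & -> & HX)]].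
    + destruct (IH _ _ _ HX) as (k' & ? & ?); exists k'; split; [constructor|]; assumption.
    + exists k; split; [constructor; assumption|]; split; [discriminate|auto].
    + destruct (IH _ _ _ HX) as (k' & ? & _ & H2).
      exists k'; split; [constructor; assumption|]; split; [discriminate|].
      intros _; apply H2; discriminate.
  - apply par_inv in Ht as (X' & Y' & -> & Ht).
    assert (HX : trans G Y l Y' \/ (Y' = Y /\ l = ATau) \/
                 exists c v, l = ASnd c v /\ trans G Y (ARcv c v) Y').
    { destruct l; simpl in Ht; intuition eauto. }
    destruct HX as [HX|[[-> ->]|(c & v & -> & HX)]].
    + destruct (IH _ _ _ HX) as (k' & ? & ?); exists k'; split; [constructor|]; assumption.
    + exists k; split; [constructor; assumption|]; split; [discriminate|auto].
    + destruct (IH _ _ _ HX) as (k' & ? & _ & H2).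
      exists k'; split; [constructor; assumption|]; split; [discriminate|].
      intros _; apply H2; discriminate.
Qed.

Lemma calls_now g X G : calls g 0 X -> closed_sys X -> exists Y, trans G X (ASnd g (err Sg)) Y.
Proof.
  intros Hk; remember 0 as k eqn:Ek.
  induction Hk as [| |k P Hk IH|k X Y Hk IH|k X Y Hk IH]; intros Hc; try discriminate.
  - eexists; apply TRec; apply TSnd; reflexivity.
  - eexists; apply TSnd; reflexivity.
  - destruct Hc as [HX HY], (IH Ek HX) as [X' HX'].
    destruct (input_enabled Y G g (err Sg) HY) as [Y' HY'].
    eexists; apply TSyncL; eassumption.
  - destruct Hc as [HX HY], (IH Ek HY) as [Y' HY'].
    destruct (input_enabled X G g (err Sg) HX) as [X' HX'].
    eexists; apply TSyncR; eassumption.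
Qed.

Lemma time_progress C : well_formed C -> exists D E, tau_star C D /\ tick D E.
Proof.
  destruct C as [G W].
  remember (load_sys W) as n eqn:Hn; revert G W Hn.
  induction n as [n IH] using lt_wf_ind; intros G W -> [Hc Hw].
  destruct (progress W G Hc Hw) as [(l & W' & Hl & Ht)|[W' Ht]].
  - assert (Hs : step (G, W) (act_env l G, W')) by (apply step_iff; eauto).
    assert (Hlt : load_sys W' < load_sys W).
    { pose proof (load_trans _ _ _ _ Ht Hc); destruct Hl as [->|(? & ? & ->)]; assumption. }
    destruct (IH _ Hlt (act_env l G) W' eq_refl) as (D & E & HD & HE).
    + eapply red_wf; [apply red_iff; left; eassumption|split; assumption].
    + exists D, E; split; [|assumption]; eapply rt_trans; [apply rt_step|]; eassumption.
  - exists (G, W); eexists; split; [apply rt_refl|]; exists W'; simpl; eauto.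
Qed.

Lemma calling_red g C D : red C D -> calling g C -> calling g D.
Proof.
  intros (l & W' & _ & Ht & ->) [k Hk].
  destruct (calls_trans _ _ _ Hk _ _ _ Ht) as (k' & ? & _); exists k'; assumption.
Qed.

Lemma calling_red_star g C D : red_star C D -> calling g C -> calling g D.
Proof. apply star_invariant; intros; eapply calling_red; eassumption. Qed.

(** Well-formedness provides the [k] time steps that bring the caller to its broadcast. *)
Lemma calling_wbarb g C : well_formed C -> calling g C -> wbarb C g.
Proof.
  intros Hw [k Hk]; revert C Hw Hk.
  induction k as [|k IH]; intros C Hw Hk.
  - destruct (calls_now g (snd C) (fst C) Hk (proj1 Hw)) as [Y HY].
    exists (bcast_env g (err Sg) (fst C), Y); split; [|apply bcast_exposed].
    apply rt_step; exists (ASnd g (err Sg)), Y; split; [discriminate|auto].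
  - destruct (time_progress C Hw) as (D & E & HD & HE).
    assert (HkD : calls g (S k) (snd D)).
    { revert HD Hk; apply star_invariant with (I := fun D => calls g (S k) (snd D)).
      intros [G W] D' Hk Hs; apply step_iff in Hs as (l & W' & Hl & Ht & ->).
      destruct (calls_trans _ _ _ Hk _ _ _ Ht) as (k' & Hk' & _ & H2).
      rewrite <- H2; [assumption| |lia].
      intros ->; destruct Hl as [?|(? & ? & ?)]; discriminate. }
    assert (HkE : calls g k (snd E)).
    { destruct HE as (W' & Ht & ->).
      destruct (calls_trans _ _ _ HkD _ _ _ Ht) as (k' & Hk' & H1 & _).
      specialize (H1 eq_refl); injection H1 as ->; assumption. }
    destruct (IH E) as (E' & Hr & Hb).
    + eapply red_wf; [apply red_iff; right; eassumption|eapply tau_star_wf; eassumption].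
    + assumption.
    + exists E'; split; [|assumption].
      eapply rt_trans; [apply tau_star_red, HD|eapply rt_trans; [apply tick_red, HE|assumption]].
Qed.

(** * Channels on which only finitely many broadcasts remain *)

Definition gentle (g : chan) C : Prop := mild g (snd C).

Lemma gentle_red g C D : red C D -> gentle g C -> gentle g D.
Proof. intros (l & W' & _ & Ht & ->) Hg; eapply trans_mild; eassumption. Qed.

Lemma gentle_red_star g C D : red_star C D -> gentle g C -> gentle g D.
Proof. apply star_invariant; intros; eapply gentle_red; eassumption. Qed.

Lemma gentle_tau_star g C D : tau_star C D -> gentle g C -> gentle g D.
Proof. intros Hs; exact (gentle_red_star g _ _ (tau_star_red _ _ Hs)). Qed.

(** Without a broadcast on [g] its remaining transmission time can only shrink; a broadcast lowers
    the syntactic count instead. *)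
Lemma red_star_decay g C D : red_star C D -> gentle g C ->
  sends g (snd D) < sends g (snd C) \/
  (sends g (snd D) <= sends g (snd C) /\ fst (fst D g) <= fst (fst C g)).
Proof.
  intros Hr Hg.
  apply (star_invariant (fun D => gentle g D /\ (sends g (snd D) < sends g (snd C) \/
    (sends g (snd D) <= sends g (snd C) /\ fst (fst D g) <= fst (fst C g)))))
    with (2 := Hr); [|auto].
  intros E E' [HE Hd] HEE; split; [eapply gentle_red; eassumption|].
  destruct HEE as (l & W' & Hl & Ht & ->); simpl.
  destruct (trans_mild _ _ _ _ Ht g HE) as (_ & Hle & Hlt).
  destruct Hd as [Hd|[Hd1 Hd2]]; [left; lia|].
  destruct l as [c v|c v| |].
  - destruct (Nat.eq_dec c g) as [->|Hc].
    + left; specialize (Hlt v eq_refl); lia.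
    + right; split; [lia|]; simpl; rewrite bcast_other; auto.
  - destruct (Hl c v eq_refl).
  - right; split; [lia|]; rewrite sigma_fst; lia.
  - right; split; [lia|assumption].
Qed.

(** Lexicographic induction on the broadcasts still available on [g] and on its remaining
    transmission time. If [g] is idle but has a weak barb, reaching the barb spends a broadcast; if
    [g] is exposed, letting time pass shortens the transmission unless a broadcast is spent. *)
Lemma gentle_cools g C : well_formed C -> gentle g C -> exists D, red_star C D /\ ~ wbarb D g.
Proof.
  remember (sends g (snd C)) as s eqn:Hs; revert C Hs.
  induction s as [s IHs] using lt_wf_ind; intros C Hs.
  remember (fst (fst C g)) as n eqn:Hn; revert C Hs Hn.
  induction n as [n IHn] using lt_wf_ind; intros C -> -> Hw Hg.
  assert (Hdown : forall D, red_star C D -> sends g (snd D) < sends g (snd C) ->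
    exists D, red_star C D /\ ~ wbarb D g).
  { intros D HD Hlt; destruct (IHs _ Hlt D eq_refl) as (D' & HD' & ?);
      [eapply red_star_wf|eapply gentle_red_star|]; eauto.
    exists D'; split; [eapply rt_trans|]; eassumption. }
  destruct (classic (idle (fst C) g)) as [Hi|Hi].
  - destruct (classic (wbarb C g)) as [(D & HD & Hb)|Hb];
      [|exists C; split; [apply rt_refl|assumption]].
    destruct (red_star_decay g _ _ HD Hg) as [Hlt|[_ Hle]]; [eauto|].
    exfalso; apply Hb; unfold idle in *; lia.
  - destruct (time_progress C Hw) as (D & E & HD & HE).
    apply tau_star_red in HD; assert (HE' := tick_red _ _ HE).
    assert (HCE : red_star C E) by (eapply rt_trans; eassumption).
    destruct (red_star_decay g _ _ HD Hg) as [Hlt|[Hs1 Hn1]]; [eauto|].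
    destruct (red_star_decay g _ _ HCE Hg) as [Hlt|[Hs2 _]]; [eauto|].
    apply Nat.lt_eq_cases in Hs2 as [Hlt|Heq]; [eauto|].
    assert (Hn2 : fst (fst E g) < fst (fst C g)).
    { destruct HE as (W' & _ & ->); change (fst (act_env ASigma (fst D) g) < fst (fst C g)).
      rewrite sigma_fst.
      unfold idle in Hi; lia. }
    destruct (IHn _ Hn2 E) as (D' & HD' & ?); auto;
      [eapply red_star_wf|eapply gentle_red_star|]; eauto.
    exists D'; split; [eapply rt_trans|]; eassumption.
Qed.

(** * Reduction barbed congruence up to strong bisimilarity *)

Lemma rbc_sym C D : rbc C D -> rbc D C.
Proof. intros (S & H1 & H2 & H3 & H4 & H5 & H6); exists S; auto 7. Qed.

Lemma rbc_par C D V : rbc C D -> closed_sys V -> rbc (par C V) (par D V).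
Proof.
  destruct C, D; intros (S & H1 & H2 & H3 & H4 & H5 & H6) HV; exists S.
  repeat (split; [assumption|]); apply H5; assumption.
Qed.

Lemma rbc_wbarb C D c : rbc C D -> wbarb C c -> wbarb D c.
Proof. intros (S & H1 & H2 & H3 & H4 & H5 & H6); eapply H3; eassumption. Qed.

Lemma rbc_red C D C' : rbc C D -> red C C' -> exists D', red_star D D' /\ rbc C' D'.
Proof.
  intros (S & H1 & H2 & H3 & H4 & H5 & H6) Hr.
  destruct (H4 _ _ _ H6 Hr) as (D' & ? & ?); exists D'; split; [assumption|]; exists S; auto 7.
Qed.

Lemma rbc_red_star C D C' : rbc C D -> red_star C C' -> exists D', red_star D D' /\ rbc C' D'.
Proof.
  intros HCD Hr; apply clos_rt_rt1n in Hr; revert D HCD.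
  induction Hr as [C|C E C' Hr _ IH]; intros D HCD; [exists D; split; [apply rt_refl|assumption]|].
  destruct (rbc_red _ _ _ HCD Hr) as (D1 & H1 & HE).
  destruct (IH _ HE) as (D2 & H2 & ?); exists D2; split; [eapply rt_trans; eassumption|assumption].
Qed.

Definition sbc C D : Prop := fst C = fst D /\ sb (snd C) (snd D).

Lemma sbc_sym C D : sbc C D -> sbc D C.
Proof. intros []; split; auto using sb_sym. Qed.

Lemma sbc_par C D V : sbc C D -> sbc (par C V) (par D V).
Proof. intros []; split; [assumption|apply sb_par; auto using sb_refl]. Qed.

Lemma sbc_red C D C' : sbc C D -> red C C' -> exists D', red D D' /\ sbc C' D'.
Proof.
  intros [HG HW] (l & W' & Hl & Ht & ->).
  destruct (sb_step _ _ HW _ _ _ Ht) as (X & HX & ?); rewrite HG in HX.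
  exists (act_env l (fst D), X); split; [exists l, X; auto|].
  split; [simpl; rewrite HG; reflexivity|assumption].
Qed.

Lemma sbc_red_star C D C' : sbc C D -> red_star C C' -> exists D', red_star D D' /\ sbc C' D'.
Proof.
  intros HCD Hr; apply clos_rt_rt1n in Hr; revert D HCD.
  induction Hr as [C|C E C' Hr _ IH]; intros D HCD; [exists D; split; [apply rt_refl|assumption]|].
  destruct (sbc_red _ _ _ HCD Hr) as (D1 & H1 & HE).
  destruct (IH _ HE) as (D2 & H2 & ?).
  exists D2; split; [eapply rt_trans; [apply rt_step|]; eassumption|assumption].
Qed.

(** Strong bisimilarity with equal environments transports barbs, reductions and contexts, so
    congruence composed with it on both sides is again a candidate relation. *)
Lemma rbc_sb C D C' D' : rbc C D -> sbc C C' -> sbc D D' -> is_config C' -> is_config D' ->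
  rbc C' D'.
Proof.
  intros HCD HC HD HC' HD'.
  exists (fun C' D' => is_config C' /\ is_config D' /\ exists C D, rbc C D /\ sbc C C' /\ sbc D D').
  split; [|split; [|split; [|split; [|split]]]].
  - tauto.
  - intros X Y (? & ? & E & F & ? & ? & ?); repeat split; auto.
    exists F, E; auto using rbc_sym.
  - intros X Y c (HX & HY & E & F & HEF & HE & HF) (X' & Hr & Hb).
    destruct (sbc_red_star _ _ _ (sbc_sym _ _ HE) Hr) as (E' & HE' & HXE).
    destruct (rbc_wbarb E F c HEF) as (F' & HF' & HbF).
    { exists E'; split; [assumption|]; unfold barb in *; destruct HXE as [<- _]; assumption. }
    destruct (sbc_red_star _ _ _ HF HF') as (Y' & HY' & HFY).
    exists Y'; split; [assumption|]; unfold barb in *; destruct HFY as [<- _]; assumption.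
  - intros X Y X' (HX & HY & E & F & HEF & HE & HF) Hr.
    destruct (sbc_red _ _ _ (sbc_sym _ _ HE) Hr) as (E' & HE' & HXE).
    destruct (rbc_red _ _ _ HEF HE') as (F' & HF' & HEF').
    destruct (sbc_red_star _ _ _ HF HF') as (Y' & HY' & HFY).
    exists Y'; split; [assumption|].
    split; [eapply red_closed; eassumption|]; split; [eapply red_star_closed; eassumption|].
    exists E', F'; auto using sbc_sym.
  - intros G1 W1 G2 W2 V (HX & HY & E & F & HEF & HE & HF) HV.
    split; [split; assumption|]; split; [split; assumption|].
    exists (par E V), (par F V); split; [apply rbc_par; assumption|].
    split; [apply (sbc_par _ _ V HE)|apply (sbc_par _ _ V HF)].
  - repeat split; auto; exists C, D; auto.
Qed.

(** The gentle side reaches a state without a weak barb on [g]. The answer is still calling, since a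
    caller never stops, and so keeps the barb. *)
Lemma rbc_calling_gentle g C D : rbc C D -> well_formed C -> well_formed D ->
  calling g C -> gentle g D -> False.
Proof.
  intros HCD HC HD Hc Hg.
  destruct (gentle_cools g D HD Hg) as (D' & HD' & Hb).
  destruct (rbc_red_star _ _ _ (rbc_sym _ _ HCD) HD') as (C' & HC' & HDC).
  apply Hb, (rbc_wbarb C' D' g (rbc_sym _ _ HDC)).
  apply calling_wbarb; [eapply red_star_wf|eapply calling_red_star]; eassumption.
Qed.

(* Congruence next to finitely many uncommitted testers, on the channels listed.  The
   channels are distinct and need only be [gentle] for the two configurations, because
   later testers may listen, send once or test exposure on them. *)
Inductive tested : list chan -> config Sg -> config Sg -> Prop :=
| tested_base C D : well_formed C -> well_formed D -> rbc C D -> tested nil C D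
| tested_peel F k g C D : gentle g C -> gentle g D -> ~ In g F ->
    tested F (par C (pending k g)) (par D (pending k g)) -> tested (g :: F) C D.

(** * Congruence beside uncommitted testers *)

Lemma wf_par C V : well_formed (par C V) <->
  well_formed C /\ closed_sys V /\ wf_sys (fst C) V.
Proof. unfold well_formed, is_config, par; simpl; tauto. Qed.

Lemma tested_wf F C D : tested F C D -> well_formed C /\ well_formed D.
Proof.
  induction 1 as [|F k g C D _ _ _ _ [H1 H2]]; [auto|].
  apply wf_par in H1, H2; tauto.
Qed.

Lemma tested_sym F C D : tested F C D -> tested F D C.
Proof. induction 1; [constructor|econstructor]; eauto using rbc_sym. Qed.

Lemma closed_pending k g : closed_sys (pending k g).
Proof. apply closed_sigma_n; simpl; repeat split; auto. Qed.

Definition quiet J : Prop := forall c, ~ rcv_sys J c.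

Lemma quiet_pending k g : quiet (pending k g).
Proof. intros c; destruct k; simpl; tauto. Qed.

Lemma quiet_nil : quiet nil_sys.
Proof. intros c []. Qed.

Lemma step_quiet C D J : quiet J -> step C D -> step (par C J) (par D J).
Proof.
  destruct C as [G W]; intros HJ Hs; apply step_iff in Hs as (l & W' & Hl & Ht & ->).
  apply step_iff; exists l, (SPar W' J); repeat split; [assumption|].
  destruct Hl as [->|(c & v & ->)]; [apply TTauParL; assumption|].
  apply TSyncL; [assumption|apply rcv_ignored, HJ].
Qed.

Lemma tau_star_quiet C D J : quiet J -> tau_star C D -> tau_star (par C J) (par D J).
Proof.
  intros HJ Hs; induction Hs; [apply rt_step, step_quiet; assumption|apply rt_refl|].
  eapply rt_trans; eassumption.
Qed.

Lemma step_right C J J' : trans (fst C) J ATau J' -> step (par C J) (par C J').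
Proof. intros Ht; apply XTau, TTauParR, Ht. Qed.

Lemma pending_inv G k g l X : trans G (pending k g) l X ->
  (exists c v, l = ARcv c v /\ X = pending k g) \/
  (exists k', l = ASigma /\ k = S k' /\ X = pending k' g) \/
  (l = ATau /\ k = 0 /\ (X = SProc (caller g) \/ X = nil_sys)).
Proof.
  destruct k as [|k]; intros Ht; inversion Ht; subst; try (left; eauto; fail);
    try (right; left; exists k; auto; fail);
    repeat match goal with
    | h : rcv _ _ _ |- _ => destruct h as [_ []]
    | h : trans _ (SProc (PTau _)) _ _ |- _ => inversion h; subst; clear h
    | h : ARcv _ _ = ATau \/ _ |- _ => destruct h as [?|(? & ? & ?)]; discriminate
    end; right; right; auto.
Qed.

Lemma pending_call G g : trans G (pending 0 g) ATau (SProc (caller g)).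
Proof. apply TSumL; [left; reflexivity|apply TTau]. Qed.

Lemma pending_quit G g : trans G (pending 0 g) ATau nil_sys.
Proof. apply TSumR; [left; reflexivity|apply TTau]. Qed.

Definition residue (g : chan) J : Prop := (exists k, J = pending k g) \/ J = nil_sys.

(** A tester whose delays are used up blocks time, so a tick can be followed only after it commits;
    the silent branch is chosen. *)
Lemma residue_follow g C D : red_star C D -> forall J, residue g J ->
  exists J', residue g J' /\ red_star (par C J) (par D J').
Proof.
  intros Hr; induction Hr as [C D Hr|C|C D E _ IH1 _ IH2]; intros J HJ.
  - apply red_iff in Hr as [Hs|Ht].
    + exists J; split; [assumption|]; apply rt_step, red_iff; left; apply step_quiet; [|assumption].
      destruct HJ as [[k ->]| ->]; [apply quiet_pending|apply quiet_nil].
    + assert (Hn : red (par C nil_sys) (par D nil_sys)).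
      { apply red_iff; right; apply tau_lift_tick; [assumption|constructor]. }
      destruct HJ as [[[|k] ->]| ->].
      * exists nil_sys; split; [right; reflexivity|].
        eapply rt_trans; [apply rt_step, red_iff; left; apply step_right, pending_quit|].
        apply rt_step, Hn.
      * exists (pending k g); split; [left; eauto|].
        apply tick_red, tau_lift_tick; [assumption|apply TSleep].
      * exists nil_sys; split; [right; reflexivity|apply rt_step, Hn].
  - exists J; split; [assumption|apply rt_refl].
  - destruct (IH1 J HJ) as (J1 & HJ1 & H1), (IH2 J1 HJ1) as (J2 & HJ2 & H2).
    exists J2; split; [assumption|eapply rt_trans; eassumption].
Qed.

Lemma sends_caller g h : g <> h -> sends_proc g (caller h) = 0.
Proof. intros Hgh; simpl; destruct (Nat.eqb_spec h g); [congruence|reflexivity]. Qed.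

Lemma mild_caller g h : g <> h -> mild_proc g (caller h).
Proof. intros Hgh; apply sends_0_mild, sends_caller, Hgh. Qed.

Lemma mild_pending g h k : g <> h -> mild g (pending k h).
Proof. intros Hgh; apply mild_sigma_n; split; [apply mild_caller, Hgh|exact I]. Qed.

Lemma residue_mild g h J : g <> h -> residue h J -> mild g J.
Proof. intros Hgh [[k ->]| ->]; [apply mild_pending, Hgh|exact I]. Qed.

Lemma calling_par g C J : calling g C -> calling g (par C J).
Proof. intros [k Hk]; exists k; apply calls_l, Hk. Qed.

(** The run of [D] is replayed beside each remaining tester in turn. Those testers use channels
    other than [g], so they disturb neither gentleness nor calling on [g], and the base case is
    [rbc_calling_gentle]. *)
Lemma tested_gentle F C D g E : tested F C D -> ~ In g F -> gentle g C ->
  red_star D E -> calling g E -> False.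
Proof.
  intros HT; revert E; induction HT as [C D HC HD HCD|F k h C D Hh1 Hh2 HF HT IH];
    intros E HgF Hg HE Hc.
  - destruct (rbc_red_star _ _ _ (rbc_sym _ _ HCD) HE) as (C' & HC' & HEC).
    eapply rbc_calling_gentle with (C := E) (D := C'); try eassumption.
    + eapply red_star_wf; eassumption.
    + eapply red_star_wf; eassumption.
    + eapply gentle_red_star; eassumption.
  - simpl in HgF.
    destruct (residue_follow h _ _ HE (pending k h)) as (J' & _ & HE'); [left; eauto|].
    apply (IH (par E J')); auto using calling_par.
    split; [assumption|]; apply mild_pending; intros ->; tauto.
Qed.

Lemma tested_calling F C D g E : tested F C D -> ~ In g F -> calling g C ->
  red_star D E -> gentle g E -> False.
Proof.
  intros HT; revert E; induction HT as [C D HC HD HCD|F k h C D Hh1 Hh2 HF HT IH];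
    intros E HgF Hg HE Hc.
  - destruct (rbc_red_star _ _ _ (rbc_sym _ _ HCD) HE) as (C' & HC' & HEC).
    eapply rbc_calling_gentle with (C := C') (D := E); try eassumption.
    + apply rbc_sym; assumption.
    + eapply red_star_wf; eassumption.
    + eapply red_star_wf; eassumption.
    + eapply calling_red_star; eassumption.
  - simpl in HgF.
    destruct (residue_follow h _ _ HE (pending k h)) as (J' & HJ' & HE'); [left; eauto|].
    apply (IH (par E J')); auto using calling_par.
    split; [assumption|]; apply (residue_mild g h); [intros ->; tauto|assumption].
Qed.

(** [gentle] is syntactic and not invariant under strong bisimilarity, so separate hypotheses
    transport it. *)
Lemma tested_sb F C D : tested F C D -> forall C' D', sbc C C' -> sbc D D' ->
  (forall g, gentle g C -> gentle g C') -> (forall g, gentle g D -> gentle g D') ->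
  well_formed C' -> well_formed D' -> tested F C' D'.
Proof.
  induction 1 as [C D HC HD HCD|F k h C D Hh1 Hh2 HF HT IH];
    intros C' D' HC' HD' HgC HgD HwC HwD.
  - constructor; [assumption..|].
    eapply rbc_sb; [eassumption..|apply HwC|apply HwD].
  - apply tested_peel with (k := k); auto.
    apply IH; auto using sbc_par.
    + intros g [H1 H2]; split; [apply HgC, H1|exact H2].
    + intros g [H1 H2]; split; [apply HgD, H1|exact H2].
    + apply wf_par; split; [assumption|]; split; [apply closed_pending|exact I].
    + apply wf_par; split; [assumption|]; split; [apply closed_pending|exact I].
Qed.

Lemma tested_nil F C D : tested F (par C nil_sys) (par D nil_sys) -> tested F C D.
Proof.
  intros HT; destruct (tested_wf _ _ _ HT) as [HC HD].
  apply wf_par in HC, HD; apply (tested_sb _ _ _ HT); try tauto.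
  - split; [reflexivity|apply sb_nil].
  - split; [reflexivity|apply sb_nil].
  - intros g []; assumption.
  - intros g []; assumption.
Qed.

(** [K] is appended beyond all pending testers, where congruence admits it, and is then moved
    inwards by [sb_swap]. *)
Lemma tested_par F C D K : tested F C D -> closed_sys K ->
  wf_sys (fst C) K -> wf_sys (fst D) K -> (forall g, In g F -> mild g K) ->
  tested F (par C K) (par D K).
Proof.
  intros HT HK; induction HT as [C D HC HD HCD|F k h C D Hh1 Hh2 HF HT IH];
    intros HwC HwD HgK.
  - constructor; [apply wf_par; auto..|apply rbc_par; assumption].
  - assert (HP := closed_pending k h).
    destruct (tested_wf _ _ _ HT) as [HC HD]; apply wf_par in HC, HD.
    apply tested_peel with (k := k); auto.
    + split; [assumption|apply HgK; left; reflexivity].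
    + split; [assumption|apply HgK; left; reflexivity].
    + apply (tested_sb F _ _ (IH HwC HwD (fun g Hg => HgK g (or_intror Hg)))).
      * split; [reflexivity|apply sb_swap].
      * split; [reflexivity|apply sb_swap].
      * intros g [[H1 H2] H3]; repeat split; assumption.
      * intros g [[H1 H2] H3]; repeat split; assumption.
      * apply wf_par; rewrite wf_par; tauto.
      * apply wf_par; rewrite wf_par; tauto.
Qed.

(** * Runs of a tester beside a configuration *)

Lemma step_par_inv C J E : step (par C J) E -> exists C' J', E = par C' J' /\
  ((step C C' /\ fst C' = fst C /\ J' = J) \/
   (exists c v, step C C' /\ fst C' = bcast_env c v (fst C) /\
      trans (fst C) J (ARcv c v) J') \/
   (C' = C /\ trans (fst C) J ATau J') \/
   (exists c v W', trans (fst C) (snd C) (ARcv c v) W' /\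
      C' = (bcast_env c v (fst C), W') /\ trans (fst C) J (ASnd c v) J')).
Proof.
  destruct C as [G W]; intros Hs; apply step_iff in Hs as (l & X & Hl & Ht & ->).
  apply par_inv in Ht as (W' & J' & -> & Ht).
  exists (act_env l G, W'), J'; split; [reflexivity|].
  destruct Hl as [->|(c & v & ->)]; simpl in Ht; destruct Ht as [[H1 H2]|[H1 H2]].
  - left; split; [apply XTau; assumption|auto].
  - subst; right; right; left; auto.
  - right; left; exists c, v; repeat split; [apply XShh|]; assumption.
  - right; right; right; exists c, v, W'; auto.
Qed.

Lemma tick_par_inv C J E : tick (par C J) E ->
  exists C' J', E = par C' J' /\ tick C C' /\ trans (fst C) J ASigma J'.
Proof.
  intros (X & Ht & ->); apply par_inv in Ht as (W' & J' & -> & H1 & H2).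
  exists (act_env ASigma (fst C), W'), J'; repeat split; [exists W'; auto|assumption].
Qed.

Lemma tau_star_snoc C D E : tau_star C D -> step D E -> tau_star C E.
Proof. intros H1 H2; eapply rt_trans; [eassumption|apply rt_step, H2]. Qed.

Lemma nil_tau D E : tau_star (par D nil_sys) E -> exists D', E = par D' nil_sys /\ tau_star D D'.
Proof.
  intros Hs; apply (star_invariant
    (fun E => exists D', E = par D' nil_sys /\ tau_star D D')) with (2 := Hs);
    [|exists D; split; [reflexivity|apply rt_refl]].
  intros X Y (D' & -> & HD') Hst.
  apply step_par_inv in Hst
    as (D2 & J' & -> & [(H1 & _ & ->)|[(c & v & H1 & _ & H2)|[[_ H2]|(c & v & W' & _ & _ & H2)]]]);
    try (apply nil_inv in H2 as [-> [H2|(? & ? & H2)]]; try discriminate);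
    exists D2; eauto using tau_star_snoc.
Qed.

Lemma calling_right g k C J : calls g k J -> calling g (par C J).
Proof. intros Hk; exists k; apply calls_r, Hk. Qed.

Lemma calling_tau_star g C D : tau_star C D -> calling g C -> calling g D.
Proof. intros Hs; exact (calling_red_star g _ _ (tau_star_red _ _ Hs)). Qed.

Lemma pending_tau k g D E : tau_star (par D (pending k g)) E ->
  (exists D', E = par D' (pending k g) /\ tau_star D D') \/
  (k = 0 /\ (calling g E \/ exists D', E = par D' nil_sys /\ tau_star D D')).
Proof.
  intros Hs; apply (star_invariant
    (fun E => (exists D', E = par D' (pending k g) /\ tau_star D D') \/
      (k = 0 /\ (calling g E \/ exists D', E = par D' nil_sys /\ tau_star D D'))))
    with (2 := Hs); [|left; exists D; split; [reflexivity|apply rt_refl]].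
  intros X Y [(D' & -> & HD')|[Hk [Hc|(D' & -> & HD')]]] Hst.
  - apply step_par_inv in Hst
      as (D2 & J' & -> & [(H1 & _ & ->)|[(c & v & H1 & _ & H2)|[[-> H2]|(c & v & W' & _ & _ & H2)]]]).
    + left; exists D2; eauto using tau_star_snoc.
    + apply pending_inv in H2 as [(? & ? & _ & ->)|[(? & ? & _)|[? _]]]; try discriminate.
      left; exists D2; eauto using tau_star_snoc.
    + apply pending_inv in H2 as [(? & ? & ? & _)|[(? & ? & _)|(_ & -> & [-> | ->])]];
        try discriminate; right; (split; [reflexivity|]).
      * left; eapply calling_right, calls_fix.
      * right; eauto.
    + apply pending_inv in H2 as [(? & ? & ? & _)|[(? & ? & _)|[? _]]]; discriminate.
  - right; split; [assumption|]; left; eapply calling_tau_star; [apply rt_step|]; eassumption.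
  - right; split; [assumption|]; right.
    destruct (nil_tau D' Y) as (D2 & -> & H2); [apply rt_step, Hst|].
    exists D2; split; [reflexivity|eapply rt_trans; eassumption].
Qed.

(** * Answers to instantaneous steps *)

Lemma red_quit g C : red_star (par C (pending 0 g)) (par C nil_sys).
Proof. apply rt_step, red_iff; left; apply step_right, pending_quit. Qed.

Lemma red_call g C : red_star (par C (pending 0 g)) (par C (SProc (caller g))).
Proof. apply rt_step, red_iff; left; apply step_right, pending_call. Qed.

(** [C] beside the uncommitted tester can still commit to the caller as well as to silence, and one
    of these futures contradicts an [E] already settled the other way. *)
Lemma tested_unresolved F C E g : tested F (par C (pending 0 g)) E -> ~ In g F -> gentle g C ->
  ~ calling g E /\ ~ gentle g E.
Proof.
  intros HT HgF Hg; apply tested_sym in HT; split; intros HE.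
  - eapply tested_calling; [eassumption..|apply red_quit|]; split; [exact Hg|exact I].
  - eapply tested_gentle; [eassumption..|apply red_call|]; eapply calling_right, calls_fix.
Qed.

(** New testers stay at or above [M], which each use sets beyond the channels to be kept apart from
    them. *)
Definition extends (M : nat) (F F' : list chan) : Prop :=
  forall x, In x F' -> In x F \/ M <= x.

Lemma fresh_chan C D M : exists f, M <= f /\ (forall g, f <= g -> gentle g C /\ gentle g D).
Proof.
  destruct (mild_bound (snd C)) as [N1 H1], (mild_bound (snd D)) as [N2 H2].
  exists (M + N1 + N2); split; [lia|]; intros g Hg; split; [apply H1|apply H2]; lia.
Qed.

Lemma wf_pending C k g : well_formed C -> well_formed (par C (pending k g)).
Proof. intros HC; apply wf_par; split; [assumption|]; split; [apply closed_pending|exact I]. Qed.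

(** An uncommitted tester has no time step, so as long as it is uncommitted every reduction was
    instantaneous. *)
Lemma choice_red_star f D E : gentle f D -> red_star (par D (pending 0 f)) E ->
  (exists D', E = par D' (pending 0 f) /\ tau_star D D') \/ calling f E \/ gentle f E.
Proof.
  intros Hf Hr; apply (star_invariant (fun E =>
    (exists D', E = par D' (pending 0 f) /\ tau_star D D') \/ calling f E \/ gentle f E))
    with (2 := Hr); [|left; exists D; split; [reflexivity|apply rt_refl]].
  intros X Y [(D' & -> & HD')|[HX|HX]] HXY.
  - apply red_iff in HXY as [Hs|Ht].
    + destruct (pending_tau 0 f D' Y) as [(D2 & -> & H2)|[_ [HY|(D2 & -> & H2)]]];
        [apply rt_step, Hs| | |].
      * left; exists D2; split; [reflexivity|eapply rt_trans; eassumption].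
      * auto.
      * right; right; split; [|exact I].
        eapply gentle_tau_star; [|eassumption]; eapply rt_trans; eassumption.
    + apply tick_par_inv in Ht as (D2 & J' & _ & _ & Ht).
      apply pending_inv in Ht as [(? & ? & ? & _)|[(? & _ & ? & _)|[? _]]]; discriminate.
  - right; left; eapply calling_red; eassumption.
  - right; right; eapply gentle_red; eassumption.
Qed.

(** Congruence alone would admit an answer that lets time pass. A new tester on [f] stops time until
    it commits, and [tested_unresolved] forbids the answer to commit it; the tester then stays in
    the list. *)
Lemma tested_step F C D C' M : tested F C D -> step C C' ->
  exists F' D', tau_star D D' /\ tested F' C' D' /\ extends M F F'.
Proof.
  intros HT; revert C' M.
  induction HT as [C D HC HD HCD|F k g C D Hg1 Hg2 HF HT IH]; intros C' M Hs.
  - destruct (fresh_chan C D M) as (f & Hf & Hfr); destruct (Hfr f (le_n f)) as [Hf1 Hf2].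
    assert (HCf : gentle f C') by (eapply gentle_red; [apply red_iff; left; exact Hs|exact Hf1]).
    destruct (rbc_red _ _ (par C' (pending 0 f)) (rbc_par C D _ HCD (closed_pending 0 f)))
      as (E & HE & HCE).
    { apply red_iff; left; apply step_quiet; [apply quiet_pending|assumption]. }
    assert (HTE : tested nil (par C' (pending 0 f)) E).
    { constructor; [| |assumption].
      - apply wf_pending; eapply red_wf; [apply red_iff; left|]; eassumption.
      - eapply red_star_wf; [eassumption|apply wf_pending; assumption]. }
    destruct (tested_unresolved _ _ _ _ HTE (fun h => h) HCf) as [N1 N2].
    destruct (choice_red_star f D E Hf2 HE) as [(D' & -> & HD')|[?|?]]; try contradiction.
    exists (f :: nil), D'; split; [assumption|]; split.
    + apply tested_peel with (k := 0); auto; eapply gentle_tau_star; eassumption.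
    + intros x [<-|[]]; auto.
  (* The bound [S g] keeps new testers off [g], so that [g] can be peeled again afterwards. *)
  - destruct (IH (par C' (pending k g)) (Nat.max M (S g))) as (F' & E & HE & HTE & HF').
    { apply step_quiet; [apply quiet_pending|assumption]. }
    assert (HgF' : ~ In g F') by (intros Hin; destruct (HF' g Hin); [tauto|lia]).
    assert (HCg : gentle g C') by (eapply gentle_red; [apply red_iff; left; exact Hs|exact Hg1]).
    destruct (pending_tau k g D E HE) as [(D' & -> & HD')|[-> HX]].
    + exists (g :: F'), D'; split; [assumption|]; split.
      * apply tested_peel with (k := k); auto; eapply gentle_tau_star; eassumption.
      * intros x [<-|Hx]; [left; left; reflexivity|].
        destruct (HF' x Hx); [left; right; assumption|right; lia].
    + destruct (tested_unresolved _ _ _ _ HTE HgF' HCg) as [N1 N2].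
      destruct HX as [?|(D' & -> & HD')]; [contradiction|].
      exfalso; apply N2; split; [eapply gentle_tau_star; eassumption|exact I].
Qed.

Lemma extends_trans M F F' F'' : extends M F F' -> extends M F' F'' -> extends M F F''.
Proof. intros H1 H2 x Hx; destruct (H2 x Hx); auto. Qed.

Lemma tested_tau_star F C D C' M : tested F C D -> tau_star C C' ->
  exists F' D', tau_star D D' /\ tested F' C' D' /\ extends M F F'.
Proof.
  intros HT Hs; revert F D HT; apply clos_rt_rt1n in Hs.
  induction Hs as [C|C E C' Hs _ IH]; intros F D HT.
  - exists F, D; split; [apply rt_refl|]; split; [assumption|intros x; auto].
  - destruct (tested_step F C D E M HT Hs) as (F1 & D1 & H1 & HT1 & HF1).
    destruct (IH F1 D1 HT1) as (F2 & D2 & H2 & HT2 & HF2).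
    exists F2, D2; split; [eapply rt_trans; eassumption|]; split; [assumption|].
    eapply extends_trans; eassumption.
Qed.

(** * Answers to time steps *)

Definition weak_tick D D' : Prop :=
  exists E E', tau_star D E /\ tick E E' /\ tau_star E' D'.

Lemma weak_tick_red D D' : weak_tick D D' -> red_star D D'.
Proof.
  intros (E & E' & H1 & H2 & H3).
  eapply rt_trans; [apply tau_star_red, H1|].
  eapply rt_trans; [apply tick_red, H2|apply tau_star_red, H3].
Qed.

Lemma weak_tick_snoc C D E : weak_tick C D -> step D E -> weak_tick C E.
Proof.
  intros (X & X' & H1 & H2 & H3) Hs; exists X, X'; eauto using tau_star_snoc.
Qed.

(* Measures the passage of exactly one time unit: the commitment to [pending 0 f]
   comes one unit after the start, and being uncommitted is observed on [h]. *)
Definition clock2 (f h : chan) : proc Sg := PSum (PTau (choice f)) (PTau (caller h)).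
Definition clock (f h : chan) : proc Sg := PSigma (clock2 f h).

Lemma closed_clock f h : closed_sys (SProc (clock f h)).
Proof. simpl; repeat split; auto. Qed.

Lemma quiet_clock f h : quiet (SProc (clock f h)).
Proof. intros c []. Qed.

Lemma clock2_inv G f h l X : trans G (SProc (clock2 f h)) l X ->
  (exists c v, l = ARcv c v /\ X = SProc (clock2 f h)) \/
  (l = ATau /\ (X = pending 0 f \/ X = SProc (caller h))).
Proof.
  intros Ht; inversion Ht; subst; try (left; eauto; fail);
    repeat match goal with
    | h : rcv _ _ _ |- _ => destruct h as [_ []]
    | h : trans _ (SProc (PTau _)) _ _ |- _ => inversion h; subst; clear h
    | h : ARcv _ _ = ATau \/ _ |- _ => destruct h as [?|(? & ? & ?)]; discriminate
    end; right; auto.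
Qed.

Lemma clock_inv G f h l X : trans G (SProc (clock f h)) l X ->
  (exists c v, l = ARcv c v /\ X = SProc (clock f h)) \/
  (l = ASigma /\ X = SProc (clock2 f h)).
Proof. intros Ht; inversion Ht; subst; eauto. Qed.

Lemma clock_call D f h : red_star (par D (SProc (clock2 f h))) (par D (SProc (caller h))).
Proof.
  apply rt_step, red_iff; left; apply step_right, TSumR; [left; reflexivity|apply TTau].
Qed.

(** [clock] takes one time step and neither [clock2] nor [pending 0 f] takes any, so reaching
    [pending 0 f] uncommitted costs exactly one unit. *)
Lemma clock_red_star f h D E : gentle f D -> f <> h -> red_star (par D (SProc (clock f h))) E ->
  (exists D', E = par D' (SProc (clock f h)) /\ tau_star D D') \/
  (exists D', E = par D' (SProc (clock2 f h)) /\ weak_tick D D') \/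
  (exists D', E = par D' (pending 0 f) /\ weak_tick D D') \/
  calling f E \/ calling h E \/ gentle f E.
Proof.
  intros Hf Hfh Hr.
  apply (star_invariant (fun E =>
    (exists D', E = par D' (SProc (clock f h)) /\ tau_star D D') \/
    (exists D', E = par D' (SProc (clock2 f h)) /\ weak_tick D D') \/
    (exists D', E = par D' (pending 0 f) /\ weak_tick D D') \/
    calling f E \/ calling h E \/ gentle f E)) with (2 := Hr);
    [|left; exists D; split; [reflexivity|apply rt_refl]].
  intros X Y [(D' & -> & HD')|[(D' & -> & HD')|[(D' & -> & HD')|[HX|[HX|HX]]]]] HXY.
  - apply red_iff in HXY as [Hs|Ht].
    + apply step_par_inv in Hs
        as (D2 & J' & -> & [(H1 & _ & ->)|[(c & v & H1 & _ & H2)|[[-> H2]|(c & v & W' & _ & _ & H2)]]]);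
        try (apply clock_inv in H2 as [(? & ? & H2 & ->)|[H2 _]]; try discriminate);
        left; exists D2; eauto using tau_star_snoc.
    + apply tick_par_inv in Ht as (D2 & J' & -> & H1 & H2).
      apply clock_inv in H2 as [(? & ? & H2 & _)|[_ ->]]; [discriminate|].
      right; left; exists D2; split; [reflexivity|].
      exists D', D2; split; [assumption|]; split; [assumption|apply rt_refl].
  - apply red_iff in HXY as [Hs|Ht].
    + apply step_par_inv in Hs
        as (D2 & J' & -> & [(H1 & _ & ->)|[(c & v & H1 & _ & H2)|[[-> H2]|(c & v & W' & _ & _ & H2)]]]);
        try (apply clock2_inv in H2 as [(? & ? & H2 & ->)|[H2 HJ]]; try discriminate).
      * right; left; exists D2; eauto using weak_tick_snoc.
      * right; left; exists D2; eauto using weak_tick_snoc.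
      * destruct HJ as [-> | ->].
        -- right; right; left; exists D'; auto.
        -- do 4 right; left; eapply calling_right, calls_fix.
    + apply tick_par_inv in Ht as (D2 & J' & _ & _ & H2).
      apply clock2_inv in H2 as [(? & ? & H2 & _)|[H2 _]]; discriminate.
  - assert (Hg : gentle f D').
    { eapply gentle_red_star; [apply weak_tick_red; eassumption|assumption]. }
    destruct (choice_red_star f D' Y Hg (rt_step _ _ _ _ HXY)) as [(D2 & -> & H2)|HY];
      [|tauto].
    right; right; left; exists D2; split; [reflexivity|].
    destruct HD' as (E1 & E2 & ? & ? & ?); exists E1, E2; repeat (split; [assumption|]).
    eapply rt_trans; eassumption.
  - do 3 right; left; eapply calling_red; eassumption.
  - do 4 right; left; eapply calling_red; eassumption.
  - do 5 right; eapply gentle_red; eassumption.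
Qed.

(** The instantaneous prefix from [C] to [C0] serves the induction: a tester with no delay left must
    quit before time can pass, and it is then dropped from the list. One with [S k] delays keeps its
    place with [k]. *)
Lemma tested_tick F C D C0 C' M : tested F C D -> tau_star C C0 -> tick C0 C' ->
  exists F' D', weak_tick D D' /\ tested F' C' D' /\ extends M F F'.
Proof.
  intros HT; revert C0 C' M.
  induction HT as [C D HC HD HCD|F k g C D Hg1 Hg2 HF HT IH]; intros C0 C' M Hs Ht.
  - destruct (fresh_chan C D M) as (f & Hf & Hfr); destruct (Hfr f (le_n f)) as [Hf1 Hf2].
    destruct (Hfr (S f) (le_S _ _ (le_n f))) as [Hh1 Hh2].
    set (h := S f) in *; assert (Hfh : f <> h) by (unfold h; lia).
    assert (HCC : red_star C C').
    { eapply rt_trans; [apply tau_star_red, Hs|apply tick_red, Ht]. }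
    assert (HCf : gentle f C') by (eapply gentle_red_star; eassumption).
    assert (HCh : gentle h C') by (eapply gentle_red_star; eassumption).
    destruct (rbc_red_star _ _ (par C' (pending 0 f)) (rbc_par C D _ HCD (closed_clock f h)))
      as (E & HE & HCE).
    { eapply rt_trans; [apply tau_star_red, (tau_star_quiet _ _ _ (quiet_clock f h) Hs)|].
      eapply rt_trans; [eapply tick_red, tau_lift_tick; [exact Ht|apply TSleep]|].
      apply rt_step, red_iff; left; apply step_right, TSumL; [left; reflexivity|apply TTau]. }
    assert (HTE : tested nil (par C' (pending 0 f)) E).
    { constructor; [| |assumption].
      - apply wf_pending; eapply red_star_wf; eassumption.
      - eapply red_star_wf; [eassumption|]; apply wf_par.
        split; [assumption|]; split; [apply closed_clock|exact I]. }
    destruct (tested_unresolved _ _ _ _ HTE (fun h => h) HCf) as [N1 N2].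
    assert (HwE := proj2 (tested_wf _ _ _ HTE)).
    assert (N3 : forall E', red_star E E' -> ~ calling h E').
    { intros E' HE' Hc; eapply tested_gentle; [exact HTE|intros []| |exact HE'|exact Hc].
      split; [exact HCh|apply mild_pending; auto]. }
    destruct (clock_red_star f h D E Hf2 Hfh HE)
      as [(D' & -> & HD')|[(D' & -> & HD')|[(D' & -> & HD')|[?|[Hc|?]]]]]; try contradiction.
    (* No time has passed in this answer: it could still tick and then call [h], whereas [C'] beside
       [pending 0 f] is gentle on [h]. *)
    + exfalso; apply wf_par in HwE as [HwD _].
      destruct (time_progress D' HwD) as (D1 & D2 & H1 & H2).
      apply (N3 (par D2 (SProc (caller h)))); [|eapply calling_right, calls_fix].
      eapply rt_trans; [apply tau_star_red, (tau_star_quiet _ _ _ (quiet_clock f h) H1)|].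
      eapply rt_trans; [eapply tick_red, tau_lift_tick; [exact H2|apply TSleep]|].
      apply clock_call.
    + exfalso; apply (N3 _ (clock_call _ _ _)); eapply calling_right, calls_fix.
    + exists (f :: nil), D'; split; [assumption|]; split.
      * apply tested_peel with (k := 0); auto.
        eapply gentle_red_star; [apply weak_tick_red|]; eassumption.
      * intros x [<-|[]]; auto.
    + exfalso; apply (N3 E); [apply rt_refl|assumption].
  - assert (HCg : gentle g C').
    { eapply gentle_red; [apply red_iff; right; exact Ht|eapply gentle_tau_star; eassumption]. }
    assert (Hlift := tau_star_quiet _ _ _ (quiet_pending k g) Hs).
    destruct k as [|k].
    + destruct (IH (par C0 nil_sys) (par C' nil_sys) (Nat.max M (S g)))
        as (F' & E & (E1 & E2 & H1 & H2 & H3) & HTE & HF').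
      { eapply tau_star_snoc; [exact Hlift|apply step_right, pending_quit]. }
      { apply tau_lift_tick; [assumption|constructor]. }
      assert (HgF' : ~ In g F') by (intros Hin; destruct (HF' g Hin); [tauto|lia]).
      destruct (pending_tau 0 g D E1 H1) as [(D1 & -> & HD1)|[_ [Hc|(D1 & -> & HD1)]]].
      * apply tick_par_inv in H2 as (D2 & J' & _ & _ & H2).
        apply pending_inv in H2 as [(? & ? & ? & _)|[(? & _ & ? & _)|[? _]]]; discriminate.
      * exfalso; eapply (tested_gentle F' (par C' nil_sys) E g E);
          [exact HTE|exact HgF'|split; [exact HCg|exact I]|apply rt_refl|].
        eapply calling_tau_star; [eassumption|].
        eapply calling_red; [apply red_iff; right; eassumption|assumption].
      * apply tick_par_inv in H2 as (D2 & J' & -> & HD2 & H2).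
        apply nil_inv in H2 as [-> _].
        destruct (nil_tau D2 E H3) as (D' & -> & HD').
        exists F', D'; split; [exists D1, D2; auto|]; split; [apply tested_nil, HTE|].
        intros x Hx; destruct (HF' x Hx); [left; right; assumption|right; lia].
    + destruct (IH (par C0 (pending (S k) g)) (par C' (pending k g)) (Nat.max M (S g)))
        as (F' & E & (E1 & E2 & H1 & H2 & H3) & HTE & HF').
      { exact Hlift. }
      { apply tau_lift_tick; [assumption|apply TSleep]. }
      assert (HgF' : ~ In g F') by (intros Hin; destruct (HF' g Hin); [tauto|lia]).
      destruct (pending_tau (S k) g D E1 H1) as [(D1 & -> & HD1)|[? _]]; [|discriminate].
      apply tick_par_inv in H2 as (D2 & J' & -> & HD2 & H2).
      apply pending_inv in H2 as [(? & ? & ? & _)|[(k' & _ & [= <-] & ->)|[? _]]];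
        try discriminate.
      assert (HDg : gentle g D2).
      { eapply gentle_red; [apply red_iff; right; exact HD2|].
        eapply gentle_tau_star; eassumption. }
      destruct (pending_tau k g D2 E H3) as [(D' & -> & HD')|[-> HX]].
      * exists (g :: F'), D'; split; [exists D1, D2; auto|]; split.
        -- apply tested_peel with (k := k); auto; eapply gentle_tau_star; eassumption.
        -- intros x [<-|Hx]; [left; left; reflexivity|].
           destruct (HF' x Hx); [left; right; assumption|right; lia].
      * destruct (tested_unresolved _ _ _ _ HTE HgF' HCg) as [N1 N2].
        destruct HX as [?|(D' & -> & HD')]; [contradiction|].
        exfalso; apply N2; split; [eapply gentle_tau_star; eassumption|exact I].
Qed.

(** * Agreement on idle channels *)

Lemma fresh_for F C D M : exists g, M <= g /\ (forall x, In x F -> x < g) /\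
  (forall h, g <= h -> gentle h C /\ gentle h D).
Proof.
  destruct (fresh_chan C D (M + S (list_max F))) as (g & Hg & Hfr).
  exists g; split; [lia|]; split; [|assumption]; intros x Hx.
  assert (HF := proj1 (list_max_le F (list_max F)) (le_n _)).
  rewrite Forall_forall in HF; specialize (HF x Hx); simpl in HF; lia.
Qed.

(** The tester branches on exposure. On the idle side it falls silent; on the exposed side no
    instantaneous answer can make [c] idle, so the calling branch is taken or remains available. *)
Lemma tested_idle F C D c : tested F C D -> idle (fst C) c -> idle (fst D) c.
Proof.
  intros HT Hi; apply NNPP; intros He.
  destruct (fresh_for F C D 0) as (g & _ & HgF & Hfr); destruct (Hfr g (le_n g)) as [Hg1 Hg2].
  set (K := SProc (PIf (BExp c) (caller g) PNil)).
  assert (HTK : tested F (par C K) (par D K)).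
  { apply tested_par; [assumption|simpl; repeat split; auto|exact I|exact I|].
    intros x Hx; split; [|exact I]; apply mild_caller; apply HgF in Hx; lia. }
  destruct (tested_step F _ _ (par C (SProc (PSigma PNil))) (S g) HTK) as (F' & E & HE & HTE & HF').
  { apply step_right, TElse; split; [intros; contradiction|discriminate]. }
  assert (HgF' : ~ In g F').
  { intros Hin; destruct (HF' g Hin) as [Hx|]; [apply HgF in Hx|]; lia. }
  assert (HX : (exists D', E = par D' K /\ exposed (fst D') c) \/ calling g E).
  { apply (star_invariant (fun E => (exists D', E = par D' K /\ exposed (fst D') c) \/ calling g E))
      with (2 := HE); [|left; exists D; auto].
    intros X Y [(D' & -> & HD')|HX] Hst;
      [|right; eapply calling_tau_star; [apply rt_step|]; eassumption].
    apply step_par_inv in Hst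
      as (D2 & J' & -> & [(H1 & H2 & ->)|[(d & u & H1 & H2 & H3)|[[-> H2]|(d & u & W' & _ & _ & H2)]]]).
    - left; exists D2; split; [reflexivity|]; rewrite H2; assumption.
    - inversion H3; subst; left; exists D2; split; [reflexivity|].
      rewrite H2; apply bcast_exposed_mono, HD'.
    - inversion H2; subst; [right|].
      + eapply calling_right, calls_sigma, calls_fix.
      + simpl in *; assert (false = true) by tauto; discriminate.
    - inversion H2. }
  assert (Hcall : exists E', red_star E E' /\ calling g E').
  { destruct HX as [(D' & -> & HD')|HX]; [|exists E; split; [apply rt_refl|assumption]].
    exists (par D' (SProc (PSigma (caller g)))); split; [|eapply calling_right, calls_sigma, calls_fix].
    apply rt_step, red_iff; left; apply step_right, TThen; simpl; tauto. }
  destruct Hcall as (E' & HE' & Hc).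
  eapply tested_gentle; [exact HTE|exact HgF'| |exact HE'|exact Hc].
  split; [exact Hg1|exact I].
Qed.

(** * Answers to inputs *)

Lemma pending_calls k g C : well_formed C ->
  exists E, red_star (par C (pending k g)) E /\ calling g E.
Proof.
  revert C; induction k as [|k IH]; intros C HC.
  - exists (par C (SProc (caller g))); split; [apply red_call|eapply calling_right, calls_fix].
  - destruct (time_progress C HC) as (D & D' & H1 & H2).
    destruct (IH D') as (E & HE & Hc).
    { eapply red_wf; [apply red_iff; right; eassumption|eapply tau_star_wf; eassumption]. }
    exists E; split; [|assumption].
    eapply rt_trans; [apply tau_star_red, (tau_star_quiet _ _ _ (quiet_pending _ _) H1)|].
    eapply rt_trans; [|exact HE]; apply tick_red, tau_lift_tick; [assumption|apply TSleep].
Qed.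

(* Broadcasts [v] on [c], unless a broadcast on [c] comes first; being uncommitted
   is observed on [h], and the broadcast having been sent on [g]. *)
Definition prober (c : chan) (v : Val Sg) (g h : chan) : sys Sg :=
  SProc (PSum (PSnd c (EVal (VCl v)) (choice g)) (PSum (PTau (caller h)) (PRcv c PNil PNil))).

Lemma prober_inv G c v g h l X : trans G (prober c v g h) l X ->
  (exists d u, l = ARcv d u /\ X = prober c v g h /\ ~ (d = c /\ idle G c)) \/
  X = SActRcv c PNil \/
  (l = ASnd c v /\ X = pending (delta Sg v) g) \/
  (l = ATau /\ X = SProc (caller h)).
Proof.
  unfold prober; intros Ht.
  repeat match goal with
  | h : trans _ (SProc (PSum _ _)) _ _ |- _ => inversion h; subst; clear h
  | h : trans _ (SProc (PSnd _ _ _)) _ _ |- _ => inversion h; subst; clear h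
  | h : trans _ (SProc (PTau _)) _ _ |- _ => inversion h; subst; clear h
  | h : trans _ (SProc (PRcv _ _ _)) _ _ |- _ => inversion h; subst; clear h
  | h : rcv _ (SProc (PSnd _ _ _)) _ |- _ => destruct h as [_ []]
  | h : rcv _ (SProc (PTau _)) _ |- _ => destruct h as [_ []]
  | h : _ = ATau \/ _ |- _ => destruct h as [h|(? & ? & h)]; try discriminate h
  end; auto; try contradiction.
  - left; do 2 eexists; repeat split; intros [-> Hi]; apply H; split; simpl; auto.
  - match goal with h : eval _ = _ |- _ => injection h as -> end; auto.
Qed.

Definition answers D (c : chan) (v : Val Sg) D' : Prop :=
  exists H X X', tau_star D (H, X) /\ (idle (fst D) c -> idle H c) /\
    trans H X (ARcv c v) X' /\ tau_star (bcast_env c v H, X') D'.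

Lemma answers_gentle D c v D' g : answers D c v D' -> gentle g D -> gentle g D'.
Proof.
  intros (H & X & X' & H1 & _ & H2 & H3) Hg.
  eapply gentle_tau_star; [eassumption|].
  assert (HX : gentle g (H, X)) by (eapply gentle_tau_star; eassumption).
  eapply trans_mild in H2; [apply H2|exact HX].
Qed.

(** A broadcast of [D] on an idle [c] wakes the receiver summand and leaves a component silent on
    [g], so an intact prober certifies that [c] is still idle if it was at the start. After its own
    broadcast the tester has a positive number of delays and cannot commit before time passes. *)
Lemma prober_tau c v g h D E : gentle g D -> tau_star (par D (prober c v g h)) E ->
  (exists D', E = par D' (prober c v g h) /\ tau_star D D' /\
     (idle (fst D) c -> idle (fst D') c)) \/
  (exists D', E = par D' (pending (delta Sg v) g) /\ answers D c v D') \/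
  calling h E \/ gentle g E.
Proof.
  intros Hg Hs; apply (star_invariant (fun E =>
    (exists D', E = par D' (prober c v g h) /\ tau_star D D' /\
      (idle (fst D) c -> idle (fst D') c)) \/
    (exists D', E = par D' (pending (delta Sg v) g) /\ answers D c v D') \/
    calling h E \/ gentle g E)) with (2 := Hs);
    [|left; exists D; split; [reflexivity|]; split; [apply rt_refl|auto]].
  intros X Y [(D' & -> & HD' & Hi)|[(D' & -> & HD')|[HX|HX]]] Hst.
  - assert (HgA : forall D2, step D' D2 -> gentle g (par D2 (SActRcv c PNil))).
    { intros D2 H2; split; [|exact I]; eapply gentle_tau_star; [|eassumption].
      eapply tau_star_snoc; eassumption. }
    apply step_par_inv in Hst
      as (D2 & J' & -> & [(H1 & H2 & ->)|[(d & u & H1 & H2 & H3)|[[-> H2]|(d & u & W' & H1 & -> & H2)]]]).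
    + left; exists D2; split; [reflexivity|]; split; [eapply tau_star_snoc; eassumption|].
      rewrite H2; assumption.
    + apply prober_inv in H3 as [(d' & u' & [= <- <-] & -> & Hd)|[->|[[? _]|[? _]]]];
        try discriminate; [|do 3 right; apply HgA, H1].
      left; exists D2; split; [reflexivity|]; split; [eapply tau_star_snoc; eassumption|].
      intros Hc; rewrite H2; apply idle_bcast; split; [|auto].
      intros ->; apply Hd; auto.
    + apply prober_inv in H2 as [(d' & u' & ? & _)|[->|[[? _]|[_ ->]]]]; try discriminate.
      * do 3 right; split; [|exact I]; eapply gentle_tau_star; eassumption.
      * right; right; left; eapply calling_right, calls_fix.
    + apply prober_inv in H2 as [(d' & u' & ? & _)|[->|[[[= -> ->] ->]|[? _]]]]; try discriminate.
      * do 3 right; split; [|exact I].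
        assert (HgD : gentle g D') by (eapply gentle_tau_star; eassumption).
        eapply trans_mild in H1; [apply H1|exact HgD].
      * right; left; eexists; split; [reflexivity|].
        destruct D' as [H X]; exists H, X, W'.
        split; [assumption|]; split; [assumption|]; split; [assumption|apply rt_refl].
  - destruct (pending_tau _ g D' Y (rt_step _ _ _ _ Hst)) as [(D2 & -> & H2)|[Hd _]].
    + right; left; exists D2; split; [reflexivity|].
      destruct HD' as (H & X & X' & A1 & A2 & A3 & A4); exists H, X, X'.
      repeat (split; [assumption|]); eapply rt_trans; eassumption.
    + pose proof (delta_pos Sg v); lia.
  - right; right; left; eapply calling_tau_star; [apply rt_step|]; eassumption.
  - do 3 right; eapply gentle_tau_star; [apply rt_step|]; eassumption.
Qed.

(** The challenge is the prober's own broadcast, received by [W]. An answer with the prober intact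
    could still call [h], and one whose prober was overtaken is gentle on [g]; both are ruled out.
    What is left is the prober's broadcast received on the answering side. *)
Lemma tested_input F G W D c v W' : tested F (G, W) D -> trans G W (ARcv c v) W' ->
  exists F' D', answers D c v D' /\ tested F' (bcast_env c v G, W') D'.
Proof.
  intros HT Ht.
  destruct (fresh_for F (G, W) D 0) as (g & _ & HgF & Hfr).
  destruct (Hfr g (le_n g)) as [Hg1 Hg2], (Hfr (S g) (le_S _ _ (le_n g))) as [Hh1 Hh2].
  set (h := S g) in *; set (C' := (bcast_env c v G, W')).
  assert (HC' : forall x, gentle x (G, W) -> gentle x C').
  { intros x Hx; eapply trans_mild in Ht; [apply Ht|exact Hx]. }
  assert (HTK : tested F (par (G, W) (prober c v g h)) (par D (prober c v g h))).
  { apply tested_par; [assumption|simpl; repeat split; auto|exact I|exact I|].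
    intros x Hx; apply HgF in Hx.
    split; [apply (mild_pending x g 0); lia|]; split; [apply mild_caller; unfold h; lia|].
    split; exact I. }
  destruct (tested_step F _ _ (par C' (pending (delta Sg v) g)) (S h) HTK)
    as (F' & E & HE & HTE & HF').
  { apply XShh, TSyncR; [assumption|]; apply TSumL; [right; eauto|apply TSnd; reflexivity]. }
  assert (HgF' : ~ In g F').
  { intros Hin; destruct (HF' g Hin) as [Hx|]; [apply HgF in Hx|]; unfold h in *; lia. }
  assert (HhF' : ~ In h F').
  { intros Hin; destruct (HF' h Hin) as [Hx|]; [apply HgF in Hx|]; unfold h in *; lia. }
  assert (HwC : well_formed C').
  { apply tested_wf in HTE as [HwC _]; apply wf_par in HwC; apply HwC. }
  assert (N1 : forall E', red_star E E' -> ~ calling h E').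
  { intros E' HE' Hc; eapply tested_gentle; [exact HTE|exact HhF'| |exact HE'|exact Hc].
    split; [apply HC', Hh1|apply mild_pending; unfold h; lia]. }
  assert (N2 : ~ gentle g E).
  { intros HgE; destruct (pending_calls (delta Sg v) g C' HwC) as (E' & HE' & Hc).
    eapply tested_gentle; [apply tested_sym; exact HTE|exact HgF'|exact HgE|exact HE'|exact Hc]. }
  destruct (prober_tau c v g h D E Hg2 HE) as [(D' & -> & _)|[(D' & -> & HD')|[Hc|?]]];
    try contradiction.
  - exfalso; apply (N1 (par D' (SProc (caller h)))); [|eapply calling_right, calls_fix].
    apply rt_step, red_iff; left; apply step_right.
    apply TSumR; [left; reflexivity|]; apply TSumL; [left; reflexivity|apply TTau].
  - exists (g :: F'), D'; split; [assumption|].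
    apply tested_peel with (k := delta Sg v); auto; eapply answers_gentle; eassumption.
  - exfalso; apply (N1 E); [apply rt_refl|assumption].
Qed.

(** * Values delivered by a time step *)

Lemma actrcv_tau c P D E : tau_star (par D (SActRcv c P)) E ->
  exists D', E = par D' (SActRcv c P).
Proof.
  intros Hs; apply (star_invariant (fun E => exists D', E = par D' (SActRcv c P)))
    with (2 := Hs); [|eauto].
  intros X Y (D' & ->) Hst.
  apply step_par_inv in Hst
    as (D2 & J' & -> & [(_ & _ & ->)|[(d & u & _ & _ & H2)|[[-> H2]|(d & u & W' & _ & _ & H2)]]]);
    try (inversion H2; subst); eauto.
Qed.

(** An active receiver on [c] observes the end of the transmission and its value. Had it ended only
    in [C], the answer would retain an active receiver on a channel that must be idle there too,
    against well-formedness; had it brought another value, the answer could fall silent. *)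
Lemma tested_last F C D C' D1 c v : tested F C D -> tick C C' -> tick D D1 ->
  fst C c = (1, v) -> fst D c = (1, v).
Proof.
  intros HT HtC HtD Hv.
  destruct (fresh_for F C D 0) as (g & _ & HgF & Hfr); destruct (Hfr g (le_n g)) as [Hg1 Hg2].
  set (P := PIf (BEq (EVal (VVar 0)) (EVal (VCl v))) (caller g) PNil).
  set (K := SActRcv c P).
  assert (HeC : exposed (fst C) c) by (unfold exposed; rewrite Hv; discriminate).
  assert (HeD : exposed (fst D) c).
  { intros Hi; apply HeC, (tested_idle F D C c); [apply tested_sym, HT|exact Hi]. }
  assert (HTK : tested F (par C K) (par D K)).
  { apply tested_par; [assumption|simpl; repeat split; auto|exact HeC|exact HeD|].
    intros x Hx; split; [|exact I]; apply mild_caller; apply HgF in Hx; lia. }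
  destruct (tested_tick F _ _ (par C K) (par C' (SProc (dsubst v P))) (S g) HTK)
    as (F1 & E & (E1 & E2 & H1 & H2 & H3) & HT1 & HF1).
  { apply rt_refl. }
  { apply tau_lift_tick; [assumption|apply TEndRcv, Hv]. }
  destruct (tested_step F1 _ E (par C' (SProc (PSigma (caller g)))) (S g) HT1)
    as (F2 & E' & HE' & HT2 & HF2).
  { apply step_right, TThen; exists v, v; tauto. }
  assert (HgF2 : ~ In g F2).
  { intros Hin; destruct (HF2 g Hin) as [Hx|]; [|lia].
    destruct (HF1 g Hx) as [Hy|]; [apply HgF in Hy|]; lia. }
  assert (N : forall Z : config Sg, red_star E' Z -> ~ gentle g Z).
  { intros Z HY HgY; eapply tested_calling; [exact HT2|exact HgF2| |exact HY|exact HgY].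
    eapply calling_right, calls_sigma, calls_fix. }
  assert (HKtick : exists Z : config Sg, tick (par D K) Z).
  { assert (HwK : wf_sys (fst D) K) by exact HeD.
    destruct (progress K (fst D)) as [(l & K' & Hl & Hk)|[K' Hk]]; auto.
    - simpl; repeat split; auto.
    - exfalso; destruct Hl as [->|(? & ? & ->)]; inversion Hk.
    - eexists; apply tau_lift_tick; eassumption. }
  destruct HKtick as [Y HY].
  (* [D] beside [K] can tick, so by maximal progress it has no instantaneous step and the answer
     begins with its tick. *)
  apply tau_star_stuck in H1; [subst E1|eapply tick_no_step; eassumption].
  assert (HEE : tau_star E2 E') by (eapply rt_trans; eassumption); clear H3 HE'.
  apply tick_par_inv in H2 as (D2 & J & -> & HD2 & HJ).
  inversion HJ; subst.
  - exfalso; apply actrcv_tau in HEE as (D' & ->).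
    destruct (tested_wf _ _ _ HT2) as [_ Hw]; apply wf_par in Hw as (_ & _ & Hw); apply Hw.
    apply (tested_idle F2 _ _ c HT2).
    destruct HtC as (X & _ & ->); unfold idle; simpl; rewrite Hv; reflexivity.
  - match goal with h : fst D c = (1, w) |- _ => rename h into Hw end.
    destruct (classic (w = v)) as [->|Hwv]; [assumption|exfalso].
    assert (HgD2 : gentle g D2).
    { eapply gentle_red; [apply red_iff; right; eassumption|assumption]. }
    assert (HX : (exists D', E' = par D' (SProc (dsubst w P)) /\ gentle g D') \/ gentle g E').
    { apply (star_invariant (fun E' =>
        (exists D', E' = par D' (SProc (dsubst w P)) /\ gentle g D') \/ gentle g E'))
        with (2 := HEE); [|eauto].
      intros X Z [(D' & -> & HD')|HX] Hst;
        [|right; eapply gentle_tau_star; [apply rt_step|]; eassumption].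
      apply step_par_inv in Hst
        as (D3 & J' & -> & [(A1 & _ & ->)|[(d & u & A1 & _ & A2)|[[-> A2]|(d & u & W' & _ & _ & A2)]]]).
      - left; exists D3; split; [reflexivity|].
        eapply gentle_tau_star; [apply rt_step|]; eassumption.
      - inversion A2; subst; left; exists D3; split; [reflexivity|].
        eapply gentle_tau_star; [apply rt_step|]; eassumption.
      - inversion A2; subst.
        + exfalso; match goal with h : beval _ _ _ |- _ => destruct h as (? & ? & B1 & B2 & B3) end.
          simpl in B1, B2; injection B1 as <-; injection B2 as <-; tauto.
        + right; split; [exact HD'|exact I].
      - inversion A2. }
    destruct HX as [(D' & -> & HD')|HX]; [|apply (N E'); [apply rt_refl|assumption]].
    apply (N (par D' (SProc (PSigma PNil)))); [|split; [exact HD'|exact I]].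
    apply rt_step, red_iff; left; apply step_right, TElse.
    exists w, v; repeat split; [congruence|discriminate].
Qed.

(** * From congruence to bisimulation *)

Lemma tested_refined : refined (fun C D => exists F, tested F C D).
Proof.
  constructor.
  - intros C D [F HT]; exists F; apply tested_sym, HT.
  - intros C D [F HT] c; split; [eapply tested_idle; exact HT|].
    eapply tested_idle, tested_sym; exact HT.
  - intros C D C' [F HT] Hs.
    destruct (tested_step F C D C' 0 HT Hs) as (F' & D' & ? & ? & _); eauto.
  - intros G W D c v W' [F HT] Ht.
    destruct (tested_input F G W D c v W' HT Ht) as (F' & D' & (H & X & X' & A1 & A2 & A3 & A4) & HT').
    exists H, X, X', D'; split; [assumption|]; split; [|eauto].
    intros Hi; apply A2; eapply tested_idle in HT; eassumption.
  - intros C D C' [F HT] Ht.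
    destruct (tested_tick F C D C C' 0 HT) as (F' & D' & (E & E' & A1 & A2 & A3) & HT' & _);
      [apply rt_refl|assumption|].
    exists E, E', D'; split; [assumption|]; split; [|eauto].
    (* The run from [D] to [E] is answered by [C], which can tick and so has no instantaneous step:
       [E] is tested against [C] itself, and both can tick as [tested_last] requires. *)
    destruct (tested_tau_star F D C E 0 (tested_sym _ _ _ HT) A1) as (F1 & C1 & HC1 & HT1 & _).
    apply tau_star_stuck in HC1; [subst C1|eapply tick_no_step; eassumption].
    intros c v; split; intros Hv.
    + eapply tested_last; [apply tested_sym; exact HT1|eassumption..].
    + eapply tested_last; [exact HT1|eassumption..].
Qed.

Lemma rbc_rbisim C D : well_formed C -> well_formed D -> rbc C D -> rbisim C D.
Proof.
  intros HC HD HCD; exists (fun C D => exists F, tested F C D).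
  split; [apply tested_refined|]; exists nil; constructor; assumption.
Qed.

(** The refined clauses imply weak matching; a delivery is matched because the state that ticks
    holds the same expiring values. Passing to [rbisim] and back returns the derivatives to
    congruence, free of testers. *)
Lemma rbc_ext C D a C' : well_formed C -> well_formed D -> rbc C D -> ext C a C' ->
  exists D', weak_hat Sg D a D' /\ well_formed C' /\ well_formed D' /\ rbc C' D'.
Proof.
  intros HC HD HCD Hx.
  assert (HB := rbc_rbisim C D HC HD HCD); assert (HR := rbisim_refined).
  enough (exists D', weak_hat Sg D a D' /\ well_formed C' /\ well_formed D' /\ rbisim C' D')
    as (D' & H1 & H2 & H3 & H4).
  { exists D'; repeat (split; [assumption|]); apply rbisim_rbc; [apply H2|apply H3|assumption]. }
  assert (Hstep : step C C' -> exists D', tau_star D D' /\ well_formed C' /\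
    well_formed D' /\ rbisim C' D').
  { intros Hs; destruct (refined_tau _ HR _ _ _ HB Hs) as (D' & HD' & HB').
    exists D'; split; [assumption|]; split; [|split; [|assumption]].
    - eapply red_wf; [apply red_iff; left; eassumption|assumption].
    - eapply tau_star_wf; eassumption. }
  assert (Htick : tick C C' -> exists E E' D', tau_star D E /\ same_last (fst C) (fst E) /\
    tick E E' /\ tau_star E' D' /\ well_formed C' /\ well_formed D' /\ rbisim C' D').
  { intros Ht; destruct (refined_time _ HR _ _ _ HB Ht) as (E & E' & D' & A1 & A2 & A3 & A4 & HB').
    exists E, E', D'; repeat (split; [assumption|]); split; [|split; [|assumption]].
    - eapply red_wf; [apply red_iff; right; eassumption|assumption].
    - eapply red_star_wf; [apply weak_tick_red; exists E, E'; eauto|assumption]. }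
  inversion Hx; subst.
  - destruct (refined_input _ HR _ _ _ _ _ _ HB H) as (H' & X & X' & D' & A1 & _ & A2 & A3 & HB').
    exists D'; split; [|split; [|split; [|assumption]]].
    + exists (H', X), (bcast_env c v H', X'); split; [assumption|]; split; [|assumption].
      apply XInput, A2.
    + destruct HC as [HC1 HC2]; split; [eapply trans_closed|eapply trans_wf]; eassumption.
    + eapply tau_star_wf; [eassumption|].
      destruct (tau_star_wf _ _ A1 HD) as [HC1 HC2].
      split; [eapply trans_closed|eapply (trans_wf _ _ _ _ A2)]; eassumption.
  - destruct Htick as (E & E' & D' & A1 & _ & (X & A2 & ->) & A3 & HB'); [exists W'; auto|].
    exists D'; split; [|assumption]; exists E; eexists; split; [eassumption|].
    split; [|eassumption]; destruct E; apply XTime, A2.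
  - apply Hstep; exact Hx.
  - apply Hstep; exact Hx.
  - destruct Htick as (E & E' & D' & A1 & A0 & (X & A2 & ->) & A3 & HB'); [exists W'; auto|].
    exists D'; split; [|assumption]; exists E; eexists; split; [eassumption|].
    split; [|eassumption]; destruct E; apply XDeliver; [apply A0; assumption|exact A2].
  - exists D; split; [|auto].
    exists D, D; split; [apply rt_refl|]; split; [|apply rt_refl].
    destruct D as [H' X]; apply XIdle.
    apply (refined_idle _ HR _ _ HB); assumption.
Qed.

Lemma rbc_bisimulation :
  bisimulation Sg (fun C D => well_formed C /\ well_formed D /\ rbc C D).
Proof.
  intros C D (HC & HD & HCD); split; intros a X Hx.
  - exact (rbc_ext C D a X HC HD HCD Hx).
  - destruct (rbc_ext D C a X HD HC (rbc_sym _ _ HCD) Hx) as (Y & H1 & H2 & H3 & H4).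
    exists Y; auto using rbc_sym.
Qed.

End Completeness.

Theorem mainTheorem20 (Sg : CCCP) :
  (forall C1 C2 : config Sg,
     well_formed Sg C1 -> well_formed Sg C2 -> rbc Sg C1 C2 -> bisimilar Sg C1 C2) /\
  bisimulation Sg (fun C1 C2 => well_formed Sg C1 /\ well_formed Sg C2 /\ rbc Sg C1 C2).
Proof.
  split; [|apply rbc_bisimulation].
  intros C1 C2 H1 H2 H3; eexists; split; [apply rbc_bisimulation|].
  exact (conj H1 (conj H2 H3)).
Qed.
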